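(* Let $\mathcal{M}$ be a finite MDP with reward function $\mathcal{R}$, let $N\in\mathbb{N}$, let $p$ be an atomic proposition, assume $s_0\in S_r$, let $\epsilon\ge0$, and let $\overline{\mathcal{M}}'$, $\overline{S}_r$, $\underline{\phi}^{\epsilon}$, $r$, $x^\star$, $\upsilon^\star$ and the linear program (LP2) be as defined in the context. Let $\lambda^\star$ be an optimal solution of (LP2), and for $\overline{s}\in\overline{S}_r$ let $\mathcal{A}^\star(\overline{s})=\{a\in\mathcal{A}(\overline{s}):\lambda^\star(\overline{s},a)>0\}$. Let $\pi^\star=(d^\star,d^\star,\ldots)$ be any stationary deterministic policy of $\overline{\mathcal{M}}'$ such that, for $\overline{s}\in\overline{S}_r$ with $\mathcal{A}^\star(\overline{s})\neq\emptyset$, $d^\star(\overline{s},a)=1$ for some (arbitrary) $a\in\mathcal{A}^\star(\overline{s})$, and in every other state $d^\star$ selects an arbitrary available action with probability one. Then $\pi^\star$ is an optimal solution of the problem $$\min_{\pi\in\Pi(\overline{\mathcal{M}}')}\ \mathbb{E}_{\overline{s}_0}^{\pi}\Big[\sum_{t=1}^{\infty}\underline{\phi}^{\epsilon}(S_t,A_t)\Big]\quad\text{subject to}\quad \mathbb{E}_{\overline{s}_0}^{\pi}\Big[\sum_{t=1}^{\infty}r(S_t,A_t)\Big]=x^{\star}.$$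
   Context: MDP. $\mathcal{M}=(S,s_0,\mathcal{A},\mathcal{P},\mathcal{AP},\mathcal{L},\mathcal{R})$ with finite state set $S$, initial state $s_0$, finite action set $\mathcal{A}$, nonempty sets $\mathcal{A}(s)\subseteq\mathcal{A}$ of available actions, transition probabilities $\mathcal{P}_{s,a,s'}\in[0,1]$ with $\sum_{s'}\mathcal{P}_{s,a,s'}=1$ for $a\in\mathcal{A}(s)$, atomic propositions $\mathcal{AP}$, labeling $\mathcal{L}:S\to 2^{\mathcal{AP}}$, reward $\mathcal{R}:S\times\mathcal{A}\to\mathbb{R}$. Policies. A decision rule assigns to each state $s$ a probability distribution $d(s,\cdot)$ on $\mathcal{A}(s)$. An ($\infty$-stage) policy is a sequence $\pi=(d_1,d_2,\ldots)$ of decision rules; it is stationary if all $d_t$ are equal, and deterministic if every $d_t(s,\cdot)$ is a point mass. $\Pi(\cdot)$ is the set of all policies of an MDP. The process starts in the initial state at stage $1$, and $(S_t,A_t)$ is the state-action pair at stage $t$. Reachability. $B\subseteq S$ is the set of states $s$ with $p\in\mathcal{L}(s)$; $S_0\subseteq S$ is the set of states from which $B$ is reached with probability $0$ under every policy; $S_r=S\setminus(B\cup S_0)$. Cost of control. With $\overline{V}_{N+1}\equiv 0$, define for $n=N,N-1,\ldots,1$: $\overline{Q}_n(s,a)=\mathcal{R}(s,a)+\sum_{s'\in S}\mathcal{P}_{s,a,s'}\overline{V}_{n+1}(s')$ and $\overline{V}_n(s)=\max_{a\in\mathcal{A}(s)}\overline{Q}_n(s,a)$. Expanded MDP. $\overline{\mathcal{M}}$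 has state set $\overline{S}=S\times\{1,\ldots,N\}$, initial state $\overline{s}_0=(s_0,1)$, actions $\mathcal{A}((s,n))=\mathcal{A}(s)$, and transition probability $\overline{\mathcal{P}}_{(s,n),a,(s',n')}=\mathcal{P}_{s,a,s'}$ if ($n\le N-1$ and $n'=n+1$) or ($n=N$ and $n'=1$), and $0$ otherwise. Put $\overline{B}=B\times\{1,\ldots,N\}$, $\overline{S}_0=S_0\times\{1,\ldots,N\}$, $\overline{S}_r=S_r\times\{1,\ldots,N\}$. $\overline{\mathcal{M}}'$ is obtained from $\overline{\mathcal{M}}$ by making all states of $\overline{B}\cup\overline{S}_0$ absorbing. $\underline{\phi}^{\epsilon}((s,n),a)=\overline{V}_n(s)-\overline{Q}_n(s,a)+\epsilon$ if $(s,n)\in\overline{S}_r$ and $a\in\mathcal{A}(s)$, and $0$ otherwise. $r(\overline{s},a)=\sum_{\overline{s}'\in\overline{B}}\overline{\mathcal{P}}_{\overline{s},a,\overline{s}'}$ if $\overline{s}\in\overline{S}_r$, and $0$ otherwise. $x^\star$ is the maximum over $\pi\in\Pi(\overline{\mathcal{M}}')$ of the probability of reaching $\overline{B}$ from $\overline{s}_0$. Linear programs. The variables are $\lambda(\overline{s},a)$ for $\overline{s}\in\overline{S}_r$, $a\in\mathcal{A}(\overline{s})$. Let $\alpha(\overline{s}_0)=1$ and $\alpha(\overline{s})=0$ for $\overline{s}\ne\overline{s}_0$. Consider the constraints (a) $\sum_{\overline{s}\in\overline{S}_r}\sum_{a\in\mathcal{A}(\overline{s})}\lambda(\overline{s},a)r(\overline{s},a)=x^\star$;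 (b) for all $\overline{s}\in\overline{S}_r$: $\sum_{a\in\mathcal{A}(\overline{s})}\lambda(\overline{s},a)-\sum_{\overline{s}'\in\overline{S}_r}\sum_{a\in\mathcal{A}(\overline{s}')}\overline{\mathcal{P}}_{\overline{s}',a,\overline{s}}\lambda(\overline{s}',a)=\alpha(\overline{s})$; (c) $\lambda(\overline{s},a)\ge0$ for all $\overline{s}\in\overline{S}_r$, $a\in\mathcal{A}(\overline{s})$. (LP1): minimize $\sum_{\overline{s}\in\overline{S}_r}\sum_{a\in\mathcal{A}(\overline{s})}\lambda(\overline{s},a)\underline{\phi}^\epsilon(\overline{s},a)$ subject to (a),(b),(c); its optimal value is $\upsilon^\star$. (LP2): minimize $\sum_{\overline{s}\in\overline{S}_r}\sum_{a\in\mathcal{A}(\overline{s})}\lambda(\overline{s},a)$ subject to (a),(b),(c) and $\sum_{\overline{s}\in\overline{S}_r}\sum_{a\in\mathcal{A}(\overline{s})}\lambda(\overline{s},a)\underline{\phi}^\epsilon(\overline{s},a)=\upsilon^\star$. *)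

(* Defs.v *)
From HB Require Import structures.
From mathcomp Require Import all_boot all_order all_algebra.
From mathcomp Require Import all_classical all_reals all_analysis.
From mathcomp Require Import ring lra.
Set Implicit Arguments.
Unset Strict Implicit.
Unset Printing Implicit Defensive.
Import Order.TTheory GRing.Theory Num.Theory.
Import numFieldNormedType.Exports.
Local Open Scope classical_set_scope.
Local Open Scope ring_scope.

(** Stages are numbered from 0: [w t], [pi t] for [t : nat] are the
    state-action pair and the decision rule of stage [t + 1]. *)

Record mdp (R : realType) := Mdp {
  state : finType;
  init : state;
  action : finType;
  avail : state -> {set action};
  trans : state -> action -> state -> R;
  avail_neq0 : forall s, avail s != finset.set0;
  trans01 : forall s a s', 0 <= trans s a s' <= 1;
  trans_sum1 : forall s a, a \in avail s -> \sum_s' trans s a s' = 1 }.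

Record labelled_mdp (R : realType) := LabelledMdp {
  base :> mdp R;
  AP : Type;
  label : state base -> set AP;
  reward : state base -> action base -> R }.

Record decision_rule (R : realType) (M : mdp R) := DecisionRule {
  dr :> state M -> action M -> R;
  dr_ge0 : forall s a, 0 <= dr s a;
  dr_avail : forall s a, a \notin avail s -> dr s a = 0;
  dr_sum1 : forall s, \sum_(a in avail s) dr s a = 1 }.

Definition policy (R : realType) (M : mdp R) := nat -> decision_rule M.

Definition stationary (R : realType) (M : mdp R) (d : decision_rule M)
  : policy M := fun _ => d.

Definition deterministic (R : realType) (M : mdp R) (d : decision_rule M) :=
  forall s, exists a, forall b, d s b = (b == a)%:R.

Lemma some_avail (R : realType) (M : mdp R) (s : state M) :
  exists a, a \in avail s.
Proof. by apply/set0Pn; exact: avail_neq0. Qed.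

Definition act0 (R : realType) (M : mdp R) (s : state M) : action M :=
  xchoose (some_avail s).

Lemma act0P (R : realType) (M : mdp R) (s : state M) : act0 s \in avail s.
Proof. exact: xchooseP (some_avail s). Qed.

Definition trajectory (R : realType) (M : mdp R) : Type :=
  nat -> state M * action M.

HB.instance Definition _ (R : realType) (M : mdp R) :=
  gen_eqMixin (trajectory M).
HB.instance Definition _ (R : realType) (M : mdp R) :=
  gen_choiceMixin (trajectory M).
HB.instance Definition _ (R : realType) (M : mdp R) :=
  isPointed.Build (trajectory M) (fun=> (init M, act0 (init M))).

Definition cylinder (R : realType) (M : mdp R) (n : nat) (w : trajectory M)
  : set (trajectory M) := [set v | forall t, (t < n)%N -> v t = w t].

Definition trajectories (R : realType) (M : mdp R) :=
  g_sigma_algebraType [set A : set (trajectory M) | exists n w, A = cylinder n w].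

Definition step_prob (R : realType) (M : mdp R) (pi : policy M) (s : state M)
    (w : trajectory M) (t : nat) : R :=
  (if t is u.+1 then trans (w u).1 (w u).2 (w t).1 else ((w t).1 == s)%:R)
  * pi t (w t).1 (w t).2.

(** [G r] is the weight of the finite sequence whose reversal is [r]. A sequence
    with these prefix weights is drawn by subdividing [0, 1[ into nested
    intervals [I r] of length [G r] and following a uniform point. *)
Section prefix_measure.
Variables (R : realType) (X : finType) (G : seq X -> R).
Hypothesis G0 : G [::] = 1.
Hypothesis G_ge0 : forall r, 0 <= G r.
Hypothesis GS : forall r, \sum_x G (x :: r) = G r.

Fixpoint rprefix (w : nat -> X) n := if n is k.+1 then w k :: rprefix w k else [::].

Let gap (x : X) r := \sum_(y <- take (index x (enum X)) (enum X)) G (y :: r).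
Let left := fix left r := if r is x :: r' then left r' + gap x r' else 0.
Let I r (u : R) := left r <= u < left r + G r.

Let split_itv (g : X -> R) (l : seq X) (a u : R) : uniq l ->
  a <= u < a + \sum_(y <- l) g y ->
  exists2 x, x \in l & a + \sum_(y <- take (index x l) l) g y <= u
                      < a + \sum_(y <- take (index x l) l) g y + g x.
Proof.
elim: l a => [|y l IH] a /=.
  by rewrite big_nil addr0 => _ /andP[h1 h2]; move: (le_lt_trans h1 h2); rewrite ltxx.
move=> /andP[yl ul]; rewrite big_cons addrA => /andP[h1 h2].
have [lt|ge] := ltP u (a + g y).
  by exists y; rewrite ?mem_head// eqxx /= big_nil addr0 h1.
have [|x xl hx] := IH (a + g y) ul; first by rewrite ge h2.
exists x; first by rewrite in_cons xl orbT.
case: eqP => [yx|_]; first by rewrite yx xl in yl.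
by rewrite /= big_cons addrA.
Qed.

Let IS r u : I r u -> exists x, I (x :: r) u.
Proof.
rewrite /I => h.
have [||x _ hx] := @split_itv (fun y => G (y :: r)) (enum X) (left r) u.
- exact: enum_uniq.
- by rewrite big_enum GS.
by exists x.
Qed.

Let gap_mono x y r : (index x (enum X) < index y (enum X))%N ->
  gap x r + G (x :: r) <= gap y r.
Proof.
move=> xy; rewrite /gap -[X in take (index y _) X](cat_take_drop (index x (enum X))).
rewrite take_cat size_take index_mem mem_enum ltnNge (ltnW xy)/= big_cat/= lerD2l.
have xE : drop (index x (enum X)) (enum X) = x :: drop (index x (enum X)).+1 (enum X).
  by rewrite (drop_nth x) ?index_mem ?mem_enum// nth_index// mem_enum.
rewrite xE -(subnSK xy) /= big_cons lerDl.
by rewrite sumr_ge0.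
Qed.

Let gap_le x r : gap x r + G (x :: r) <= G r.
Proof.
rewrite -[G r in leRHS]GS -big_enum /= -[X in _ <= \sum_(_ <- X) _](cat_take_drop (index x (enum X))).
rewrite big_cat lerD2l (drop_nth x) ?index_mem ?mem_enum// nth_index ?mem_enum//.
by rewrite big_cons lerDl sumr_ge0.
Qed.

Let gap_ge0 x r : 0 <= gap x r. Proof. exact: sumr_ge0. Qed.

Let I_sub x r u : I (x :: r) u -> I r u.
Proof. by rewrite /I /=; have := gap_ge0 x r; have := gap_le x r; lra. Qed.

Let I_inj r r' u : size r = size r' -> I r u -> I r' u -> r = r'.
Proof.
elim: r r' => [|x r IH] [|y r']//= [sz] Ix Iy.
have rr' : r = r' by apply: IH => //; [exact: I_sub Ix|exact: I_sub Iy].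
subst r'; congr cons.
have [xy|yx|xy] := ltngtP (index x (enum X)) (index y (enum X)).
- exfalso; move: Ix Iy; rewrite /I /=; have := @gap_mono _ _ r xy; lra.
- exfalso; move: Ix Iy; rewrite /I /=; have := @gap_mono _ _ r yx; lra.
- have := congr1 (nth x (enum X)) xy.
  by rewrite !nth_index ?mem_enum.
Qed.

Let I01 r u : I r u -> I [::] u.
Proof. by elim: r => // x r IH /I_sub. Qed.

Variable x0 : X.
Let next r u := odflt x0 [pick x | I (x :: r) u].
Let code u := fix code n := if n is k.+1 then next (code k) u :: code k else [::].
Let traj u : nat -> X := if I [::] u then fun n => next (code u n) u else fun=> x0.

Let size_code u n : size (code u n) = n.
Proof. by elim: n => //= n ->. Qed.

Let I_code u n : I [::] u -> I (code u n) u.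
Proof.
move=> I0; elim: n => //= n IH; rewrite /next; case: pickP => //= h.
by have [x] := IS IH; rewrite h.
Qed.

Let size_rprefix w n : size (rprefix w n) = n.
Proof. by elim: n => //= n ->. Qed.

Let rprefix_traj u n : I [::] u -> rprefix (traj u) n = code u n.
Proof. by move=> I0; elim: n => //= n ->; rewrite /traj I0. Qed.

Lemma prefix_probability_exists d (T : measurableType d)
    (f : T -> nat -> X) (g : (nat -> X) -> T) (C : set (set T)) :
  cancel g f -> cancel f g ->
  @measurable _ T = <<s C >> ->
  (forall A, C A -> exists n w, A = [set v | rprefix (f v) n = rprefix w n]) ->
  exists P : probability T R,
    forall n w, P [set v | rprefix (f v) n = rprefix w n] = (G (rprefix w n))%:E.
Proof.
move=> gf fg mC CE.
pose D : set R := [set u | I [::] u].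
have IE r : [set u | I r u] = `[left r, left r + G r[%classic.
  by apply/seteqP; split => u /=; rewrite in_itv.
have preE n w : (g \o traj) @^-1` [set v | rprefix (f v) n = rprefix w n] `&` D
   = [set u | I (rprefix w n) u].
  apply/seteqP; split => u /=.
    by rewrite gf => -[+ Du]; rewrite rprefix_traj// => <-; exact: I_code.
  move=> Iu; have Du := I01 Iu; split => //; rewrite gf rprefix_traj//.
  by apply: (I_inj _ (I_code _ Du) Iu); rewrite size_code size_rprefix.
have mI r : measurable ([set u | I r u] : set (measurableTypeR R)) by rewrite IE; exact: measurable_itv.
have mf : measurable_fun [set: measurableTypeR R] (g \o traj : measurableTypeR R -> T).
  apply: (measurability C mC) => _ [A /CE[n [w ->]] <-]; rewrite setTI.
  set E := _ @^-1` _.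
  have -> : E = (E `&` D) `|` (E `&` ~` D) by rewrite -setIUr setUv setIT.
  apply: measurableU; first by rewrite preE.
  have -> : E `&` ~` D = if pselect (rprefix (fun=> x0) n = rprefix w n) then ~` D else set0.
    case: pselect => h; apply/seteqP; split => u //=.
    - by case.
    - by move=> nDu; split => //; rewrite /E /= gf /traj; case: ifP nDu.
    - by case; rewrite /E /= gf /traj /D /=; case: ifP => // _ /h.
  case: pselect => h; last exact: measurable0.
  by apply: measurableC; exact: mI.
have mD : measurable D by exact: mI.
pose mu : {measure set (measurableTypeR R) -> \bar R} := mrestr (@lebesgue_measure R) mD.
have PE n w : mu ((g \o traj) @^-1` [set v | rprefix (f v) n = rprefix w n]) = (G (rprefix w n))%:E.
  rewrite /mu /= /mrestr preE IE lebesgue_measure_itv /= lte_fin ltrDl.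
  have := G_ge0 (rprefix w n); rewrite le_eqVlt => /orP[/eqP<-|->].
    by rewrite ltxx.
  by rewrite -EFinD addrC addKr.
have muT : mu setT = 1%E.
  have := PE 0%N (fun=> x0); rewrite /= G0 => <-; congr (mu _).
  by apply/seteqP; split.
pose P : probability (measurableTypeR R) R := HB.pack (Measure.sort mu) (Measure_isProbability.Build _ _ _ (Measure.sort mu) muT).
pose Y : {mfun (measurableTypeR R) >-> T} := HB.pack (g \o traj) (isMeasurableFun.Build _ _ (measurableTypeR R) T (g \o traj) mf).
exists (distribution P Y) => n w; exact: PE.
Qed.
End prefix_measure.

Section trajectory_measure_exists.
Variables (R : realType) (M : mdp R) (pi : policy M) (s : state M).

Let G := fix G (r : seq (state M * action M)) : R :=
  if r is x :: r' then
    G r' * ((if r' is y :: _ then trans y.1 y.2 x.1 else (x.1 == s)%:R)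
            * pi (size r') x.1 x.2)
  else 1.

Let G_ge0 r : 0 <= G r.
Proof.
elim: r => [|x r IH] /=; first exact: ler01.
rewrite mulr_ge0// mulr_ge0//; last exact: dr_ge0.
by case: r {IH} => [|y r]; [exact: ler0n|case/andP: (trans01 y.1 y.2 x.1)].
Qed.

Let dr_sumT (d : decision_rule M) u : \sum_a d u a = 1.
Proof.
rewrite -[RHS](dr_sum1 d u) [in LHS](bigID (fun a => a \in avail u)) /=.
by rewrite [X in _ + X]big1 ?addr0// => a; exact: dr_avail.
Qed.

Let GS r : \sum_x G (x :: r) = G r.
Proof.
have sumE (g : state M -> R) n : \sum_(x : state M * action M) g x.1 * pi n x.1 x.2
    = \sum_u g u.
  rewrite -(pair_big predT predT (fun u a => g u * pi n u a)) /=.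
  by apply: eq_bigr => u _; rewrite -mulr_sumr dr_sumT mulr1.
case: r => [|y r] /=.
  rewrite -mulr_sumr mul1r (sumE (fun u => (u == s)%:R)) (bigD1 s)//= eqxx.
  by rewrite big1 ?addr0// => u /negbTE ->.
rewrite -mulr_sumr (sumE (fun u => trans y.1 y.2 u)).
have [ya|yna] := boolP (y.2 \in avail y.1); first by rewrite trans_sum1 ?mulr1.
by rewrite [pi (size r) _ _]dr_avail// !(mulr0, mul0r).
Qed.

Let G_rprefix (w : trajectory M) n :
  G (rprefix w n) = \prod_(t < n) step_prob pi s w t.
Proof.
elim: n => [|n IH] /=; first by rewrite big_ord0.
rewrite big_ord_recr /= -IH; congr (_ * _).
have -> : size (rprefix w n) = n by elim: n {IH} => //= n ->.
by case: n {IH}.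
Qed.

Let cylinderE n (w : trajectory M) :
  cylinder n w = [set v | rprefix v n = rprefix w n].
Proof.
apply/seteqP; split => v /=; rewrite /cylinder /=.
  elim: n => //= n IH h; rewrite h// IH// => t tn; apply: h; exact: ltnW.
elim: n => //= n IH [vw /IH h] t; rewrite ltnS leq_eqVlt => /orP[/eqP->//|].
exact: h.
Qed.

Lemma trajectory_measure_exists : exists P : probability (trajectories M) R,
  forall n w, P (cylinder n w) = (\prod_(t < n) step_prob pi s w t)%:E.
Proof.
have [||||P PE] := @prefix_probability_exists R _ G erefl G_ge0 GS
    (init M, act0 (init M)) _ (trajectories M) id id
    [set A : set (trajectory M) | exists n w, A = cylinder n w].
- by [].
- by [].
- by [].
- by move=> A [n [w ->]]; exists n, w; rewrite cylinderE.
by exists P => n w; rewrite cylinderE -G_rprefix -PE.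
Qed.

End trajectory_measure_exists.

(** The law of the process started in [s] and controlled by [pi]; it is
    determined by [trajectory_measureE], the cylinders being stable under
    intersection (up to the empty set) and generating the sigma-algebra. *)
Definition trajectory_measure (R : realType) (M : mdp R) (pi : policy M)
    (s : state M) : probability (trajectories M) R :=
  projT1 (cid (trajectory_measure_exists pi s)).

Lemma trajectory_measureE (R : realType) (M : mdp R) (pi : policy M)
    (s : state M) (n : nat) (w : trajectory M) :
  trajectory_measure pi s (cylinder n w)
  = (\prod_(t < n) step_prob pi s w t)%:E.
Proof. exact: (projT2 (cid (trajectory_measure_exists pi s))). Qed.

Definition reach_prob (R : realType) (M : mdp R) (pi : policy M) (s : state M)
    (B : {set state M}) : \bar R :=
  trajectory_measure pi s [set w : trajectory M | exists t, (w t).1 \in B].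

Definition expected_total (R : realType) (M : mdp R) (pi : policy M)
    (s : state M) (f : state M -> action M -> R) : \bar R :=
  (\int[trajectory_measure pi s]_w
     \sum_(0 <= t <oo) (f ((w : trajectory M) t).1 ((w : trajectory M) t).2)%:E)%E.

Definition is_minimizer d (V : porderType d) (T : Type) (F : set T)
    (obj : T -> V) (x : T) : Prop :=
  F x /\ forall y, F y -> (obj x <= obj y)%O.

Section absorbing.
Variables (R : realType) (M : mdp R) (C : {set state M}).

Definition absorbing_trans (s : state M) (a : action M) (s' : state M) : R :=
  if s \in C then (s' == s)%:R else trans s a s'.

Lemma absorbing_trans01 s a s' : 0 <= absorbing_trans s a s' <= 1.
Proof.
rewrite /absorbing_trans; case: ifP => _; last exact: trans01.
by rewrite ler0n lern1 leq_b1.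
Qed.

Lemma absorbing_trans_sum1 s a :
  a \in avail s -> \sum_s' absorbing_trans s a s' = 1.
Proof.
rewrite /absorbing_trans; case: (s \in C) => sa; last exact: trans_sum1.
by rewrite (bigD1 s)//= eqxx big1 ?addr0// => u /negbTE ->.
Qed.

Definition absorbing : mdp R :=
  @Mdp R (state M) (init M) (action M) (@avail R M) absorbing_trans
    (@avail_neq0 R M) absorbing_trans01 absorbing_trans_sum1.

End absorbing.

Section expanded.
Variables (R : realType) (M : mdp R) (N : nat) (N_gt0 : (0 < N)%N).

(** [i : 'I_N] stands for the stage [i + 1] in {1, ..., N}. *)
Definition next_stage (i j : 'I_N) : bool :=
  ((i.+1 < N)%N && (j == i.+1 :> nat)) || ((i.+1 == N) && (j == 0%N :> nat)).

Definition expanded_trans (s : state M * 'I_N) (a : action M)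
    (s' : state M * 'I_N) : R :=
  if next_stage s.2 s'.2 then trans s.1 a s'.1 else 0.

Lemma expanded_trans01 s a s' : 0 <= expanded_trans s a s' <= 1.
Proof.
by rewrite /expanded_trans; case: ifP => _; [exact: trans01|rewrite lexx ler01].
Qed.

Lemma expanded_trans_sum1 (s : state M * 'I_N) a :
  a \in avail s.1 -> \sum_s' expanded_trans s a s' = 1.
Proof.
move=> sa; case: s sa => s i /= sa.
have [j jP] : exists j, forall k, next_stage i k = (k == j).
  have := ltn_ord i; rewrite leq_eqVlt => /orP[/eqP iN|iN].
    by exists (Ordinal N_gt0) => k; rewrite /next_stage -val_eqE /= iN ltnn eqxx.
  by exists (Ordinal iN) => k; rewrite /next_stage -val_eqE /= iN (ltn_eqF iN) orbF.
rewrite -(pair_big predT predT (fun u k => expanded_trans (s, i) a (u, k))) /=.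
rewrite -[RHS](trans_sum1 sa); apply: eq_bigr => u _.
rewrite (bigD1 j)//= big1 ?addr0 => [|k /negbTE kj].
  by rewrite /expanded_trans /= jP eqxx.
by rewrite /expanded_trans /= jP kj.
Qed.

Definition expanded : mdp R :=
  @Mdp R (state M * 'I_N)%type (init M, Ordinal N_gt0) (action M)
    (fun s => avail s.1) expanded_trans (fun s => avail_neq0 s.1)
    expanded_trans01 expanded_trans_sum1.

End expanded.

Section cost_of_control.
Variables (R : realType) (M : labelled_mdp R).

Definition backup (V : state M -> R) (s : state M) (a : action M) : R :=
  reward s a + \sum_s' trans s a s' * V s'.

(** The default value of the iterated maximum is one of its terms. *)
Definition max_avail (Q : state M -> action M -> R) (s : state M) : R :=
  \big[Num.max/Q s (act0 s)]_(a in avail s) Q s a.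

Definition Vbar (N n : nat) : state M -> R :=
  iter (N.+1 - n) (fun V => max_avail (backup V)) (fun=> 0).

Definition Qbar (N n : nat) : state M -> action M -> R :=
  backup (Vbar N n.+1).

Lemma Vbar_last N : Vbar N N.+1 = fun=> 0.
Proof. by rewrite /Vbar subnn. Qed.

Lemma VbarE N n : (n <= N)%N -> Vbar N n = max_avail (Qbar N n).
Proof. by move=> nN; rewrite /Vbar subSn// /Qbar /Vbar subSS. Qed.

End cost_of_control.

Section reachability_cost_problem.
Variables (R : realType) (M : labelled_mdp R) (p : AP M).

Definition target : {set state M} := [set s | `[< label s p >]]%SET.

Definition unreaching : {set state M} :=
  [set s | `[< forall pi : policy M, reach_prob pi s target = 0%E >]]%SET.

Definition remaining : {set state M} := ~: (target :|: unreaching).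

Variables (N : nat) (N_gt0 : (0 < N)%N).

Local Notation Mbar := (expanded M N_gt0).

Definition lift_set (C : {set state M}) : {set state Mbar} :=
  [set s : state M * 'I_N | s.1 \in C]%SET.

Local Notation Bbar := (lift_set target).
Local Notation Srbar := (lift_set remaining).

Definition expanded_absorbing : mdp R :=
  absorbing (Bbar :|: lift_set unreaching).

Definition phi (eps : R) (s : state Mbar) (a : action Mbar) : R :=
  if (s \in Srbar) && (a \in avail s)
  then Vbar N s.2.+1 s.1 - Qbar N s.2.+1 s.1 a + eps else 0.

Definition reach_reward (s : state Mbar) (a : action Mbar) : R :=
  if s \in Srbar then \sum_(s' in Bbar) trans s a s' else 0.

Definition xstar : \bar R :=
  ereal_sup [set reach_prob pi (init expanded_absorbing) Bbar
            | pi in [set: policy expanded_absorbing]].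

(** An assignment of the variables of the linear programs is a function on all
    pairs, of which only the values at [s \in Srbar], [a \in avail s] are used. *)
Definition lp_sum (lam f : state Mbar -> action Mbar -> R) : R :=
  \sum_(s in Srbar) \sum_(a in avail s) lam s a * f s a.

Definition lp_feasible (lam : state Mbar -> action Mbar -> R) : Prop :=
  [/\ (lp_sum lam reach_reward)%:E = xstar,
      forall s, s \in Srbar ->
        \sum_(a in avail s) lam s a
        - \sum_(s' in Srbar) \sum_(a in avail s') trans s' a s * lam s' a
        = (s == init Mbar)%:R
    & forall s a, s \in Srbar -> a \in avail s -> 0 <= lam s a].

Definition vstar (eps : R) : \bar R :=
  ereal_inf [set (lp_sum lam (phi eps))%:E | lam in lp_feasible].

Definition lp2_feasible (eps : R) (lam : state Mbar -> action Mbar -> R) : Prop :=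
  lp_feasible lam /\ (lp_sum lam (phi eps))%:E = vstar eps.

Definition lp2_objective (lam : state Mbar -> action Mbar -> R) : R :=
  \sum_(s in Srbar) \sum_(a in avail s) lam s a.

Definition lp2_optimal (eps : R) : (state Mbar -> action Mbar -> R) -> Prop :=
  is_minimizer (lp2_feasible eps) lp2_objective.

Definition Astar (lam : state Mbar -> action Mbar -> R) (s : state Mbar)
  : {set action Mbar} := [set a in avail s | 0 < lam s a]%SET.

Definition maximally_reaching : set (policy expanded_absorbing) :=
  [set pi | expected_total pi (init expanded_absorbing) reach_reward = xstar].

Definition expected_cost (eps : R) (pi : policy expanded_absorbing) : \bar R :=
  expected_total pi (init expanded_absorbing) (phi eps).

End reachability_cost_problem.

Arguments xstar {R M} p {N} N_gt0.
Arguments lp_feasible {R M} p {N} N_gt0 lam.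
Arguments vstar {R M} p {N} N_gt0 eps.
Arguments lp2_feasible {R M} p {N} N_gt0 eps lam.
Arguments lp2_optimal {R M} p {N} N_gt0 eps lam.
Arguments maximally_reaching {R M} p {N} N_gt0 pi.
Arguments expected_cost {R M} p {N} N_gt0 eps pi.

(* Main.v *)
(* Occupation measures of policies satisfy the flow constraints of the linear
   programs, and conversely. The maximal reachability value [value] (the limit
   of value iteration) is superharmonic and positive on the remaining states, so
   under a maximally reaching policy the mass on the remaining states tends to
   0. Stop such a policy after n steps and go on with the chain [blend_chain],
   which mixes all value-conserving actions and therefore leaves the remaining
   states almost surely: this gives a feasible point of (LP1) whose cost exceeds
   that of the policy by a vanishing amount. Hence the optimal value of (LP1)
   bounds all policies from below, also when occupation measures are infinite.
   For the converse, the selected deterministic rule stays in the support of the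
   optimal point [lam] of (LP2). It has no recurrent class there, since
   subtracting a small multiple of an invariant measure from [lam] would shorten
   [lam]; its occupation measure [mu] is thus finite, and both [lam] and
   [lam + eta (lam - mu)] being feasible for small eta > 0 forces [mu] to be
   optimal as well. *)

Require Import Defs.
From HB Require Import structures.
From mathcomp Require Import all_boot all_order all_algebra.
From mathcomp Require Import all_classical all_reals all_analysis measurable_realfun.
From mathcomp Require Import ring lra.
Set Implicit Arguments.
Unset Strict Implicit.
Unset Printing Implicit Defensive.
Import Order.TTheory GRing.Theory Num.Theory.
Import numFieldNormedType.Exports.
Local Open Scope classical_set_scope.
Local Open Scope ring_scope.

(** * Marginals of the trajectory measure *)

Section finite_partition.
Variables (d : measure_display) (T : measurableType d) (R : realType).
Variables (X : finType) (g : T -> X).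

Lemma finite_partitionE (A : set T) :
  A = \bigcup_(x in [set: X]) (A `&` g @^-1` [set x]).
Proof.
apply/seteqP; split => [w Aw|w [x _ []//]].
by exists (g w).
Qed.

Lemma measurable_finite_partition (A : set T) :
  (forall x, measurable (A `&` g @^-1` [set x])) -> measurable A.
Proof.
move=> mA; rewrite (finite_partitionE A).
by apply: fin_bigcup_measurable => // x _.
Qed.

Lemma measure_finite_partition (mu : {measure set T -> \bar R}) (A : set T) :
  (forall x, measurable (A `&` g @^-1` [set x])) ->
  mu A = (\sum_x mu (A `&` g @^-1` [set x]))%E.
Proof.
move=> mA; rewrite [in LHS](finite_partitionE A) (measure_fin_bigcup mu finite_finset)//.
  rewrite (fsbig_finite _ _ finite_finset)/=; apply: perm_big.
  apply: uniq_perm; rewrite ?index_enum_uniq ?finmap.fset_uniq// => x.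
  by rewrite mem_index_enum (in_fset_set finite_finset) mem_set.
by move=> x y _ _ [w [[_ <-] [_ <-]]].
Qed.

End finite_partition.

Section marginals.
Variables (R : realType) (M : mdp R) (pi : policy M) (s0 : state M).
Local Notation X := (state M * action M)%type.
Local Notation Pr := (trajectory_measure pi s0).

Lemma measurable_cylinder n (w : trajectory M) :
  measurable (cylinder n w : set (trajectories M)).
Proof. by apply: sub_sigma_algebra; exists n, w. Qed.

Definition update (w : trajectory M) n (x : X) : trajectory M :=
  fun t => if t == n then x else w t.

Lemma cylinderS n (w : trajectory M) x :
  cylinder n w `&` (fun v : trajectory M => v n) @^-1` [set x]
  = cylinder n.+1 (update w n x).
Proof.
apply/seteqP; split => v; rewrite /cylinder /update /=.
  move=> [vw vx] t; rewrite ltnS leq_eqVlt.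
  by case: eqP => [->//|_ /= /vw].
move=> h; split=> [t tn|]; last by have := h n (ltnSn n); rewrite eqxx.
by have := h t (ltnW tn); rewrite (ltn_eqF tn).
Qed.

Let coord k (w : trajectories M) : X := (w : trajectory M) k.

(** Splitting on the coordinates n-1, ..., 0 in turn carries a property from the cylinders of length
    [n] to the one of length 0, which is the whole space. *)
Lemma cylinder_ind (Q : set (trajectories M) -> Prop) n :
  (forall w, Q (cylinder n w)) ->
  (forall A k, (forall x,
     Q (A `&` (fun v : trajectory M => v k) @^-1` [set x])) -> Q A) ->
  Q setT.
Proof.
move=> Qn QS.
have Qk j w : Q (cylinder (n - j) w).
  elim: j w => [|j IH] w; first by rewrite subn0.
  have [nj|jn] := leqP n j.
    move: (leqW nj) (IH w); rewrite -!subn_eq0 => /eqP ->.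
    by rewrite (eqP (_ : (n - j)%N == 0%N)) ?subn_eq0.
  apply: (QS _ (n - j.+1)%N) => x.
  by rewrite cylinderS subnSK.
have := Qk n (point : trajectory M); rewrite subnn.
by congr Q; apply/seteqP; split.
Qed.

Definition visit n (x : X) : set (trajectories M) :=
  (fun w : trajectory M => w n) @^-1` [set x].

Lemma cylinder_visit n w x :
  cylinder n.+1 w `&` visit n x = if w n == x then cylinder n.+1 w else set0.
Proof.
case: eqP => [<-|wx]; apply/seteqP; split => v //=.
- by case.
- by move=> vw; split => //; rewrite /visit /= vw.
- by move=> [vw]; rewrite /visit /= vw.
Qed.

Lemma measurable_visit n x : measurable (visit n x).
Proof.
rewrite -[visit n x]setTI.
apply: (@cylinder_ind (fun A => measurable (A `&` visit n x)) n.+1) => [w|A k mA].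
  by rewrite cylinder_visit; case: ifP => _; [exact: measurable_cylinder|].
apply: (@measurable_finite_partition _ (trajectories M) _ (coord k)) => y.
by rewrite setIAC.
Qed.

Definition marginal n (x : X) : R := fine (Pr (visit n x)).

Lemma marginalE n x : Pr (visit n x) = (marginal n x)%:E.
Proof. by rewrite fineK// fin_num_measure//; exact: measurable_visit. Qed.

Lemma marginal_ge0 n x : 0 <= marginal n x.
Proof. exact: fine_ge0. Qed.

Lemma marginal0 x : marginal 0 x = (x.1 == s0)%:R * pi 0%N x.1 x.2.
Proof.
rewrite /marginal.
have -> : visit 0 x = cylinder 1 (fun=> x).
  apply/seteqP; split => v; rewrite /visit /cylinder /=.
    by move=> vx [|t].
  by move=> ->.
by rewrite trajectory_measureE big_ord1 /step_prob.
Qed.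

Definition kernel n (x y : X) : R := trans x.1 x.2 y.1 * pi n.+1 y.1 y.2.

(** The Markov property. On a cylinder of length [n.+1] it compares two consecutive products of
    [step_prob]. Both sides are additive under finite partitions; measurability is carried along in
    the induction because additivity asks for it. *)
Lemma visit_visitS n x y :
  Pr (visit n x `&` visit n.+1 y) = ((kernel n x y)%:E * Pr (visit n x))%E.
Proof.
have mVV A k : measurable (A `&` visit n x) ->
    measurable (A `&` (visit n x `&` visit n.+1 y)).
  by move=> mA; rewrite setIA; apply: measurableI => //; exact: measurable_visit.
suff [] : measurable (setT `&` visit n x) /\ Pr (setT `&` (visit n x `&` visit n.+1 y))
    = ((kernel n x y)%:E * Pr (setT `&` visit n x))%E by rewrite !setTI.
apply: (@cylinder_ind (fun A => measurable (A `&` visit n x) /\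
   Pr (A `&` (visit n x `&` visit n.+1 y))
    = ((kernel n x y)%:E * Pr (A `&` visit n x))%E) n.+1) => [w|A k mA].
  rewrite setIA cylinder_visit; case: eqP => wx; last first.
    by split => //; rewrite set0I measure0 mule0.
  split; first exact: measurable_cylinder.
  rewrite cylinderS !trajectory_measureE -EFinM big_ord_recr/= mulrC.
  congr (_ * _)%:E.
    by rewrite /step_prob /update eqxx (ltn_eqF (ltnSn n)) wx.
  apply: eq_bigr => -[t /= tn] _; rewrite /step_prob /update (ltn_eqF tn).
  by case: t tn => // t tn; rewrite (ltn_eqF (ltnW tn)).
split.
  apply: (@measurable_finite_partition _ (trajectories M) _ (coord k)) => z.
  by rewrite setIAC; case: (mA z).
rewrite (@measure_finite_partition _ (trajectories M) _ _ (coord k)); last first.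
  by move=> z; rewrite setIAC; apply: mVV => //; case: (mA z).
rewrite [in RHS](@measure_finite_partition _ (trajectories M) _ _ (coord k)); last first.
  by move=> z; rewrite setIAC; case: (mA z).
rewrite ge0_sume_distrr//; apply: eq_bigr => z _.
by rewrite setIAC [in RHS]setIAC; case: (mA z).
Qed.

Lemma marginalS n y : marginal n.+1 y = \sum_x kernel n x y * marginal n x.
Proof.
apply: EFin_inj; rewrite -marginalE -sumEFin.
rewrite (@measure_finite_partition _ (trajectories M) _ _ (coord n)).
  apply: eq_bigr => x _; rewrite setIC EFinM -marginalE.
  exact: visit_visitS.
move=> x; apply: measurableI; exact: measurable_visit.
Qed.

(** Tonelli for a nonnegative series; at each stage the integrand is a finite combination of
    indicators of the sets [visit t x]. *)
Lemma expected_totalE (f : state M -> action M -> R) :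
  (forall s a, 0 <= f s a) ->
  expected_total pi s0 f
  = (\sum_(0 <= t <oo) (\sum_x marginal t x * f x.1 x.2)%:E)%E.
Proof.
move=> f_ge0; rewrite /expected_total.
have fE t (w : trajectories M) : (f (w t).1 (w t).2)%:E
    = (\sum_x (f x.1 x.2)%:E * (\1_(visit t x) w)%:E)%E.
  rewrite (bigD1 ((w : trajectory M) t))//= indicE mem_set// mule1 big1 ?adde0// => x xw.
  by rewrite indicE memNset ?mule0// => /= h; rewrite /visit /= in h; rewrite h eqxx in xw.
have m1 t x : measurable_fun [set: trajectories M]
   (fun w => ((f x.1 x.2)%:E * (\1_(visit t x) w)%:E)%E).
  apply: measurable_funeM.
  apply/measurable_EFinP; apply: measurable_indic.
  exact: measurable_visit.
rewrite integral_nneseries//=; last 2 first.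
- move=> t; apply: (@eq_measurable_fun _ _ _ _ _
      (fun w => \sum_x ((f x.1 x.2)%:E * (\1_(visit t x) w)%:E)%E)%E).
    by move=> w _; rewrite -fE.
  exact: emeasurable_sum.
- by move=> t w _; rewrite lee_fin.
apply: eq_eseriesr => t _.
rewrite (eq_integral _ _ (fun w _ => fE t w)).
rewrite ge0_integral_sum//=; last by move=> x w _; rewrite mule_ge0 ?lee_fin.
rewrite -sumEFin; apply: eq_bigr => x _.
rewrite ge0_integralZl_EFin//; last first.
  by apply/measurable_EFinP; apply: measurable_indic; exact: measurable_visit.
rewrite integral_indic//; last exact: measurable_visit.
by rewrite setIT muleC EFinM -marginalE.
Qed.

Lemma visit_in_fiber (B : {set state M}) t x :
  [set w : trajectory M | (w t).1 \in B] `&` (fun w : trajectory M => w t) @^-1` [set x]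
  = if x.1 \in B then visit t x else set0.
Proof.
case: ifPn => xB; apply/seteqP; split => w //=; rewrite /visit /=.
- by case.
- by move=> ->.
- by move=> [+ wx]; rewrite wx (negbTE xB).
Qed.

Lemma measurable_visit_in (B : {set state M}) t :
  measurable ([set w : trajectory M | (w t).1 \in B] : set (trajectories M)).
Proof.
apply: (@measurable_finite_partition _ (trajectories M) _ (coord t)) => x.
by rewrite visit_in_fiber; case: ifP => _; [exact: measurable_visit|].
Qed.

Lemma prob_visit_in (B : {set state M}) t :
  Pr [set w : trajectory M | (w t).1 \in B]
  = (\sum_(x : X | x.1 \in B) marginal t x)%:E.
Proof.
rewrite (@measure_finite_partition _ (trajectories M) _ _ (coord t)).
  rewrite -sumEFin [RHS]big_mkcond; apply: eq_bigr => x _.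
  by rewrite visit_in_fiber; case: ifP => _; [rewrite -marginalE|rewrite measure0].
by move=> x; rewrite visit_in_fiber; case: ifP => _; [exact: measurable_visit|].
Qed.

Lemma reachE (B : {set state M}) :
  [set w : trajectory M | exists t, (w t).1 \in B]
  = \bigcup_t [set w : trajectory M | (w t).1 \in B].
Proof. by apply/seteqP; split => [w [t wt]|w [t _ wt]]; exists t. Qed.

Lemma le_reach_prob (B : {set state M}) t :
  ((\sum_(x : X | x.1 \in B) marginal t x)%:E <= reach_prob pi s0 B)%E.
Proof.
rewrite -prob_visit_in; apply: le_measure; rewrite ?inE.
- exact: measurable_visit_in.
- by rewrite reachE; apply: bigcup_measurable => n _; exact: measurable_visit_in.
- by move=> w wt; exists t.
Qed.

Lemma reach_prob_eq0 (B : {set state M}) :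
  (forall t x, x.1 \in B -> marginal t x = 0) -> reach_prob pi s0 B = 0%E.
Proof.
move=> B0; apply/negligibleP.
  by rewrite reachE; apply: bigcup_measurable => n _; exact: measurable_visit_in.
rewrite reachE; apply: negligible_bigcup => t; apply/negligibleP.
  exact: measurable_visit_in.
by rewrite [LHS]prob_visit_in big1// => x; exact: B0.
Qed.

End marginals.

(** * Transient substochastic kernels *)

Section substochastic.
Variables (R : realType) (T : finType) (Q : T -> T -> R).
Hypothesis Q_ge0 : forall s t, 0 <= Q s t.
Hypothesis Q_le1 : forall s, \sum_t Q s t <= 1.

(** For a finite substochastic kernel this says that no class is recurrent: mass eventually leaks
    out from everywhere. *)
Definition transient := forall x : T -> R, (forall s, 0 <= x s) ->
  (forall t, x t = \sum_s x s * Q s t) -> forall s, x s = 0.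

Lemma sum_push (x w : T -> R) :
  \sum_t (\sum_s x s * Q s t) * w t = \sum_s x s * \sum_t Q s t * w t.
Proof.
under eq_bigr do rewrite mulr_suml.
rewrite exchange_big /=; apply: eq_bigr => s _.
by rewrite mulr_sumr; apply: eq_bigr => t _; rewrite mulrA.
Qed.

Lemma sum_push1 (x : T -> R) :
  \sum_t \sum_s x s * Q s t = \sum_s x s * \sum_t Q s t.
Proof.
by rewrite exchange_big; apply: eq_bigr => s _; rewrite mulr_sumr.
Qed.

(** A substochastic kernel cannot increase total mass, so the nonnegative differences sum to at most
    0 and all vanish. *)
Lemma subinvariant_invariant (x : T -> R) : (forall s, 0 <= x s) ->
  (forall t, x t <= \sum_s x s * Q s t) -> forall t, x t = \sum_s x s * Q s t.
Proof.
move=> x_ge0 x_le.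
have sum_le : \sum_t (\sum_s x s * Q s t) <= \sum_t x t.
  by rewrite sum_push1; apply: ler_sum => s _; rewrite ler_piMr.
have eq0 : \sum_t (\sum_s x s * Q s t - x t) = 0.
  apply/eqP; rewrite eq_le sumr_ge0 ?andbT => [|t _]; last by rewrite subr_ge0.
  by rewrite sumrB subr_le0.
move=> t; apply/esym/eqP; rewrite -subr_eq0; apply/eqP.
by apply: (psumr_eq0P _ eq0) => // u _; rewrite subr_ge0.
Qed.

Hypothesis trQ : transient.

(** The triangle inequality makes the absolute value of [x] subinvariant. *)
Lemma transient_fixed0 (x : T -> R) :
  (forall t, x t = \sum_s x s * Q s t) -> forall s, x s = 0.
Proof.
move=> xE s; apply/eqP; rewrite -normr_eq0; apply/eqP.
apply: (trQ (x := fun s => `|x s|)) => // {s}.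
apply: subinvariant_invariant => // t.
rewrite {1}xE (le_trans (ler_norm_sum _ _ _))//.
by apply: ler_sum => s _; rewrite normrM (ger0_norm (Q_ge0 s t)).
Qed.

(** The negative part of [x] is subinvariant, hence zero by transience. *)
Lemma transient_solution_ge0 (a x : T -> R) : (forall s, 0 <= a s) ->
  (forall t, x t = a t + \sum_s x s * Q s t) -> forall s, 0 <= x s.
Proof.
move=> a_ge0 xE s.
suff : Num.max 0 (- x s) = 0 by move/eqP; rewrite eq_maxl oppr_le0.
apply: (trQ (x := fun s => Num.max 0 (- x s))) => [t|]; first by rewrite le_max lexx.
apply: subinvariant_invariant => [t|t]; first by rewrite le_max lexx.
rewrite ge_max sumr_ge0 => [|u _]; last by rewrite mulr_ge0// le_max lexx.
rewrite /= {1}xE opprD (@le_trans _ _ (- \sum_u x u * Q u t))//.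
  by rewrite gerDr oppr_le0.
rewrite -sumrN; apply: ler_sum => u _.
by rewrite -mulNr ler_wpM2r// le_max lexx orbT.
Qed.

(** The matrix of I - Q, acting on measures as rows and on functions as columns. *)
Let resolvent_mx : 'M[R]_#|T| :=
  \matrix_(i, j) ((i == j)%:R - Q (enum_val i) (enum_val j)).

Let sum_enum (F : T -> R) : \sum_(i < #|T|) F (enum_val i) = \sum_t F t.
Proof. by rewrite -(big_enum_val F). Qed.

Let sum_delta n (F : 'I_n -> R) j : \sum_(i < n) F i * (i == j)%:R = F j.
Proof.
rewrite (bigD1 j)//= eqxx mulr1 big1 ?addr0// => i /negbTE ->.
by rewrite mulr0.
Qed.

Let mulr_resolvent (x : 'rV[R]_#|T|) j : (x *m resolvent_mx) 0 j
  = x 0 j - \sum_t x 0 (enum_rank t) * Q t (enum_val j).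
Proof.
rewrite mxE -(sum_enum (fun t => _)) -[in RHS](sum_delta (fun i => x 0 i) j) -sumrB.
by apply: eq_bigr => i _; rewrite !mxE enum_valK mulrBr.
Qed.

Let resolvent_unit : resolvent_mx \in unitmx.
Proof.
rewrite -row_free_unit; apply: inj_row_free => x x0.
apply/rowP => j; rewrite mxE -(enum_valK j).
apply: (transient_fixed0 (x := fun t => x 0 (enum_rank t))) => t.
have := mulr_resolvent x (enum_rank t); rewrite x0 mxE enum_rankK => /esym/eqP.
by rewrite subr_eq0 => /eqP.
Qed.

Lemma transient_solution (a : T -> R) :
  exists x : T -> R, forall t, x t = a t + \sum_s x s * Q s t.
Proof.
pose x := (\row_j a (enum_val j)) *m invmx resolvent_mx.
exists (fun t => x 0 (enum_rank t)) => t.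
have := mulr_resolvent x (enum_rank t).
by rewrite mulmxKV// mxE enum_rankK => ->; rewrite subrK.
Qed.

Lemma transient_cosolution (f : T -> R) :
  exists h : T -> R, forall s, h s = f s + \sum_t Q s t * h t.
Proof.
pose h := invmx resolvent_mx *m (\col_j f (enum_val j)).
exists (fun t => h (enum_rank t) 0) => s.
have : (resolvent_mx *m h) (enum_rank s) 0 = f s by rewrite mulKVmx// mxE enum_rankK.
rewrite mxE => <-.
rewrite -(sum_enum (fun t => Q s t * _)) -big_split /=.
rewrite -[LHS](sum_delta (fun i => h i 0) (enum_rank s)); apply: eq_bigr => i _.
by rewrite !mxE enum_valK enum_rankK [in RHS]eq_sym mulrBl subrK mulrC.
Qed.

(** Both sides are a (I - Q)^-1 f: the occupation measure paired with [f], or the initial mass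
    paired with the expected total of [f]. *)
Lemma transient_pairing (a x f h : T -> R) :
  (forall t, x t = a t + \sum_s x s * Q s t) ->
  (forall s, h s = f s + \sum_t Q s t * h t) ->
  \sum_s x s * f s = \sum_s a s * h s.
Proof.
move=> xE hE.
have -> : \sum_s x s * f s = \sum_s (x s * h s - x s * \sum_t Q s t * h t).
  by apply: eq_bigr => s _; rewrite [h s in RHS]hE; ring.
have -> : \sum_s a s * h s = \sum_s (x s * h s - (\sum_t x t * Q t s) * h s).
  by apply: eq_bigr => s _; rewrite {1}xE; ring.
by rewrite !sumrB sum_push.
Qed.

(** The partial occupations increase and stay below [x]; their limit solves the equation of [x],
    whose solution is unique by [transient_fixed0]. *)
Lemma transient_occupation_cvg (a x : T -> R) (L : nat -> T -> R) :
  (forall s, 0 <= a s) -> (forall t, x t = a t + \sum_s x s * Q s t) ->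
  (forall s, L 0%N s = 0) ->
  (forall n t, L n.+1 t = a t + \sum_s L n s * Q s t) ->
  forall s, L ^~ s @ \oo --> x s.
Proof.
move=> a_ge0 xE L0 LS.
have x_ge0 := transient_solution_ge0 a_ge0 xE.
have L_le n s : L n s <= x s.
  elim: n s => [|n IH] s; first by rewrite L0.
  rewrite LS xE lerD2l; apply: ler_sum => t _.
  by rewrite ler_wpM2r.
have L_nd n s : L n s <= L n.+1 s.
  elim: n s => [|n IH] s.
    by rewrite LS L0 addr_ge0// sumr_ge0// => t _; rewrite L0 mul0r.
  rewrite [L n.+1 s]LS [L n.+2 s]LS lerD2l; apply: ler_sum => t _.
  by rewrite ler_wpM2r.
have L_cvg s : cvgn (L ^~ s).
  apply: nondecreasing_is_cvgn; first exact/nondecreasing_seqP.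
  by exists (x s) => _ [n _ <-].
pose l s := limn (L ^~ s).
have lE t : l t = a t + \sum_s l s * Q s t.
  have cvg1 : (fun n => L n.+1 t) @ \oo --> l t.
    by rewrite (cvg_shiftS (L ^~ t)); exact: L_cvg.
  have cvg2 : (fun n => L n.+1 t) @ \oo --> a t + \sum_s l s * Q s t.
    under eq_fun do rewrite LS.
    apply: cvgD; first exact: cvg_cst.
    apply: cvg_big => [|s _]; first exact: add_continuous.
    apply: cvgM; [exact: L_cvg|exact: cvg_cst].
  exact: (cvg_unique _ cvg1 cvg2).
move=> s; suff -> : x s = l s by exact: L_cvg.
apply/eqP; rewrite -subr_eq0; apply/eqP.
apply: (transient_fixed0 (x := fun s => x s - l s)) => t.
rewrite xE lE opprD addrACA subrr add0r -sumrB.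
by apply: eq_bigr => u _; rewrite mulrBl.
Qed.

End substochastic.

(** * Flows and reachability values *)

(** Source of the step sizes of the perturbations below. The default 1 of the minimum gives the
    bound by 1 and covers the case of no positive value. *)
Lemma lower_bound_of_positives (R : realType) (I : finType) (F : I -> R) :
  exists eta : R, [/\ 0 < eta, eta <= 1 & forall i, 0 < F i -> eta <= F i].
Proof.
exists (\big[Num.min/1]_(i | 0 < F i) F i); split.
- by apply: lt_bigmin.
- exact: bigmin_le_id.
- by move=> i Fi; apply: bigmin_le_cond.
Qed.

Section transient_occupation.
Variables (R : realType) (S A : finType) (Sr B : {set S}) (av : S -> {set A}).
Variable P : S -> A -> S -> R.

(** For the expanded MDP, this and the next two definitions unfold to [lp_sum], the left side of the
    flow constraint and [reach_reward]. *)
Definition occ_sum (lam f : S -> A -> R) : R :=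
  \sum_(s in Sr) \sum_(a in av s) lam s a * f s a.

Definition net_outflow (lam : S -> A -> R) (s : S) : R :=
  \sum_(a in av s) lam s a
  - \sum_(s' in Sr) \sum_(a in av s') P s' a s * lam s' a.

Definition exit_prob (s : S) (a : A) : R :=
  if s \in Sr then \sum_(s' in B) P s a s' else 0.

Definition propagate (w : S -> R) (s : S) (a : A) : R :=
  \sum_(s' in Sr) P s a s' * w s'.

Definition lookahead (w : S -> R) (s : S) (a : A) : R :=
  exit_prob s a + propagate w s a.

Lemma eq_occ_sum (lam lam' f f' : S -> A -> R) :
  (forall s a, s \in Sr -> a \in av s -> lam s a * f s a = lam' s a * f' s a) ->
  occ_sum lam f = occ_sum lam' f'.
Proof. by move=> e; apply: eq_bigr => s sr; apply: eq_bigr => a sa; exact: e. Qed.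

Lemma occ_sumD (lam f g : S -> A -> R) :
  occ_sum lam (fun s a => f s a + g s a) = occ_sum lam f + occ_sum lam g.
Proof.
rewrite -big_split; apply: eq_bigr => s _; rewrite -big_split.
by apply: eq_bigr => a _; rewrite mulrDr.
Qed.

Lemma occ_sum_lin (k : R) (lam mu f : S -> A -> R) :
  occ_sum (fun s a => lam s a + k * mu s a) f = occ_sum lam f + k * occ_sum mu f.
Proof.
rewrite mulr_sumr -big_split; apply: eq_bigr => s _.
rewrite mulr_sumr -big_split.
by apply: eq_bigr => a _; rewrite mulrDl mulrA.
Qed.

Lemma net_outflow_lin (k : R) (lam mu : S -> A -> R) s :
  net_outflow (fun s a => lam s a + k * mu s a) s
  = net_outflow lam s + k * net_outflow mu s.
Proof.
rewrite /net_outflow big_split -mulr_sumr /=.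
rewrite (_ : \sum_(s' in Sr) _ = \sum_(s' in Sr) \sum_(a in av s') P s' a s * lam s' a
  + k * \sum_(s' in Sr) \sum_(a in av s') P s' a s * mu s' a); first by ring.
rewrite mulr_sumr -big_split; apply: eq_bigr => s' _.
rewrite mulr_sumr -big_split; apply: eq_bigr => a _ /=; ring.
Qed.

Lemma occ_sum_ge0 (lam f : S -> A -> R) :
  (forall s a, s \in Sr -> a \in av s -> 0 <= lam s a) ->
  (forall s a, s \in Sr -> a \in av s -> 0 <= f s a) -> 0 <= occ_sum lam f.
Proof.
move=> lam_ge0 f_ge0; apply: sumr_ge0 => s sr; apply: sumr_ge0 => a sa.
by rewrite mulr_ge0 ?lam_ge0 ?f_ge0.
Qed.

(** Linear programming duality: the transpose of the flow operator sends a potential [w] to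
    [w s - propagate w s a]. *)
Lemma occ_sum_outflow (lam : S -> A -> R) (w : S -> R) :
  occ_sum lam (fun s a => w s - propagate w s a)
  = \sum_(s in Sr) net_outflow lam s * w s.
Proof.
rewrite (occ_sumD lam (fun s a => w s) (fun s a => - propagate w s a)).
under [RHS]eq_bigr do rewrite mulrBl.
rewrite sumrB; congr (_ + _).
  by apply: eq_bigr => s _; rewrite mulr_suml.
rewrite -[LHS]opprK; congr (- _).
under [RHS]eq_bigr do rewrite mulr_suml.
rewrite [RHS]exchange_big /= -sumrN; apply: eq_bigr => s _.
under [RHS]eq_bigr do rewrite mulr_suml.
rewrite [RHS]exchange_big /= -sumrN; apply: eq_bigr => a _.
rewrite mulrN opprK mulr_sumr; apply: eq_bigr => s' _.
by ring.
Qed.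

Hypothesis P_ge0 : forall s a s', 0 <= P s a s'.
Hypothesis P_sum1 : forall s a, a \in av s -> \sum_s' P s a s' = 1.
Hypothesis B_Sr : forall s, s \in B -> s \notin Sr.
Hypothesis av_neq0 : forall s, exists a, a \in av s.
(** Combinatorial form of the fact that from every remaining state some policy reaches [B]: the
    states where this fails would form a set [Z] without exit. *)
Hypothesis no_trap : forall Z : {set S}, Z \subset Sr -> Z != finset.set0 ->
  exists s a s', [/\ s \in Z, a \in av s, s' \in B :|: (Sr :\: Z) & 0 < P s a s'].

Lemma exit_prob_ge0 s a : 0 <= exit_prob s a.
Proof. by rewrite /exit_prob; case: ifP => // _; exact: sumr_ge0. Qed.

Lemma propagate_ge0 w s a : (forall s, 0 <= w s) -> 0 <= propagate w s a.
Proof. by move=> w0; apply: sumr_ge0 => s' _; rewrite mulr_ge0. Qed.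

Lemma lookahead_ge0 w s a : (forall s, 0 <= w s) -> 0 <= lookahead w s a.
Proof. by move=> w0; rewrite addr_ge0 ?exit_prob_ge0 ?propagate_ge0. Qed.

Lemma exit_remain_le1 s a : a \in av s ->
  \sum_(s' in B) P s a s' + \sum_(s' in Sr) P s a s' <= 1.
Proof.
move=> sa; rewrite -(P_sum1 sa) [leRHS](bigID (fun s' => s' \in Sr))/= addrC lerD//.
rewrite [leRHS](bigID (fun s' => s' \in B))/= -[leLHS]addr0 lerD ?sumr_ge0//.
rewrite le_eqVlt; apply/orP; left; apply/eqP; apply: eq_bigl => s'.
by rewrite andb_idl//; exact: B_Sr.
Qed.

Lemma lookahead_le1 w s a : (forall s, w s <= 1) -> a \in av s ->
  lookahead w s a <= 1.
Proof.
move=> w1 sa; apply: le_trans (exit_remain_le1 sa).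
rewrite /lookahead lerD//; first by rewrite /exit_prob; case: ifP => // _; exact: sumr_ge0.
by apply: ler_sum => s' _; rewrite ler_piMr.
Qed.

Lemma lookahead_mono w w' s a :
  (forall s, s \in Sr -> w s <= w' s) -> lookahead w s a <= lookahead w' s a.
Proof.
by move=> ww'; rewrite lerD2l; apply: ler_sum => s' sr; rewrite ler_wpM2l ?ww'.
Qed.

(** * Value iteration and its limit *)

Lemma best_action (f : A -> R) s :
  exists2 a, a \in av s & forall b, b \in av s -> f b <= f a.
Proof.
have [a0 sa0] := av_neq0 s.
by case: (Order.TotalTheory.arg_maxP f sa0) => a sa h; exists a.
Qed.

(** On [Sr] this is the largest probability of entering [B] within [n] steps; the reward is earned
    on entering, so the reading does not extend outside [Sr]. The default 0 is harmless because
    [lookahead] is nonnegative here. *)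
Fixpoint value_iter n (s : S) : R :=
  if n is k.+1 then \big[Num.max/0]_(a in av s) lookahead (value_iter k) s a
  else 0.

Lemma value_iter_ge0 n s : 0 <= value_iter n s.
Proof. by case: n => //= n; exact: bigmax_ge_id. Qed.

Lemma lookahead_le_value_iter n s a : a \in av s ->
  lookahead (value_iter n) s a <= value_iter n.+1 s.
Proof. by move=> sa; apply: le_bigmax_cond. Qed.

Lemma value_iter_best n s :
  exists2 a, a \in av s & value_iter n.+1 s = lookahead (value_iter n) s a.
Proof.
have [a sa best] := best_action (lookahead (value_iter n) s) s.
exists a => //; apply/eqP; rewrite eq_le lookahead_le_value_iter// andbT.
by apply: bigmax_le => //; apply: lookahead_ge0; exact: value_iter_ge0.
Qed.

Lemma value_iter_le1 n s : value_iter n s <= 1.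
Proof.
elim: n s => [|n IH] s; first exact: ler01.
by have [a sa ->] := value_iter_best n s; exact: lookahead_le1.
Qed.

Lemma value_iterS n s : value_iter n s <= value_iter n.+1 s.
Proof.
elim: n s => [|n IH] s; first exact: value_iter_ge0.
have [a sa ->] := value_iter_best n s.
by apply: le_trans (lookahead_le_value_iter _ sa); exact: lookahead_mono.
Qed.

Definition value (s : S) : R := limn (value_iter ^~ s).

Lemma value_iter_cvg s : value_iter ^~ s @ \oo --> value s.
Proof.
apply: nondecreasing_is_cvgn; first by apply/nondecreasing_seqP => n; exact: value_iterS.
by exists 1 => _ [n _ <-]; exact: value_iter_le1.
Qed.

Lemma value_iter_le_value n s : value_iter n s <= value s.
Proof.
apply: (nondecreasing_cvgn_le (u_ := value_iter ^~ s)).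
  by apply/nondecreasing_seqP => k; exact: value_iterS.
exact: value_iter_cvg.
Qed.

Lemma value_le s u : (forall n, value_iter n s <= u) -> value s <= u.
Proof.
by move=> h; apply: limr_le; [exact: value_iter_cvg|exact: nearW].
Qed.

Lemma value_ge0 s : 0 <= value s. Proof. exact: (value_iter_le_value 0). Qed.

Lemma value_le1 s : value s <= 1.
Proof. by apply: value_le => n; exact: value_iter_le1. Qed.

Lemma lookahead_value_le s a : a \in av s -> lookahead value s a <= value s.
Proof.
move=> sa.
have cvg1 : (fun n => lookahead (value_iter n) s a) @ \oo --> lookahead value s a.
  apply: cvgD; first exact: cvg_cst.
  apply: cvg_big => [|s' _]; first exact: add_continuous.
  by apply: cvgM; [exact: cvg_cst|exact: value_iter_cvg].
rewrite -(cvg_lim _ cvg1)//; apply: limr_le; first exact: cvgP cvg1.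
apply: nearW => n; apply: le_trans (lookahead_le_value_iter _ sa) _.
exact: value_iter_le_value.
Qed.

(** [lookahead] is monotone, so by induction every iterate stays below [w]. *)
Lemma value_le_superharmonic (w : S -> R) :
  (forall s, s \in Sr -> 0 <= w s) ->
  (forall s a, s \in Sr -> a \in av s -> lookahead w s a <= w s) ->
  forall s, s \in Sr -> value s <= w s.
Proof.
move=> w_ge0 w_sup s sr; apply: value_le => n.
elim: n s sr => [|n IH] s sr; first exact: w_ge0.
have [a sa ->] := value_iter_best n s.
by apply: le_trans (w_sup _ _ sr sa); exact: lookahead_mono.
Qed.

(** The zeros of [value] in [Sr] would form a trap: the exit given by [no_trap] makes [lookahead]
    positive at a state of value 0. *)
Lemma value_gt0 s : s \in Sr -> 0 < value s.
Proof.
move=> sr; rewrite lt_neqAle value_ge0 andbT eq_sym; apply/negP => vs0.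
pose Z := [set u in Sr | value u == 0]%SET.
have [||u [a [u' [uZ ua u'Z Pu]]]] := no_trap (Z := Z).
- by apply/fintype.subsetP => u; rewrite inE => /andP[].
- by apply/set0Pn; exists s; rewrite inE sr.
move: uZ; rewrite inE => /andP[ur /eqP vu0].
have := lookahead_value_le ua; rewrite vu0 leNgt => /negP; apply.
move: u'Z; rewrite inE => /orP[u'B|].
  rewrite ltr_wpDr ?propagate_ge0//; first exact: value_ge0.
  by rewrite /exit_prob ur (bigD1 u')//= ltr_wpDr ?sumr_ge0.
rewrite !inE negb_and => /andP[+ u'r]; rewrite u'r /= => vu'.
rewrite ltr_wpDl ?exit_prob_ge0// /propagate (bigD1 u')//= ltr_wpDr//.
  by rewrite sumr_ge0// => t _; rewrite mulr_ge0// value_ge0.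
by rewrite mulr_gt0// lt_neqAle value_ge0 eq_sym vu'.
Qed.

(** An action best for the limit dominates the best action of every iterate. *)
Lemma value_conserving s : s \in Sr ->
  exists2 a, a \in av s & lookahead value s a = value s.
Proof.
move=> sr; have [a sa best] := best_action (lookahead value s) s.
exists a => //; apply/eqP; rewrite eq_le lookahead_value_le//=.
apply: value_le => -[|n]; first by apply: lookahead_ge0; exact: value_ge0.
have [b sb ->] := value_iter_best n s.
apply: le_trans (best _ sb); apply: lookahead_mono => u _.
exact: value_iter_le_value.
Qed.

(** * Value-conserving actions and the chain blending them *)

Definition shortfall (s : S) (a : A) : R := value s - lookahead value s a.

Lemma shortfall_ge0 s a : a \in av s -> 0 <= shortfall s a.
Proof. by move=> sa; rewrite subr_ge0 lookahead_value_le. Qed.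

Definition conserving (s : S) : {set A} :=
  [set a in av s | lookahead value s a == value s]%SET.

(* Otherwise lowering [value] slightly on [Z] would give a smaller superharmonic
   function: non-conserving actions have room, and conserving ones never leave
   [Z] except towards states of value 0. *)
Lemma conserving_no_trap (Z : {set S}) : Z \subset Sr -> Z != finset.set0 ->
  exists s a s', [/\ s \in Z, a \in conserving s, s' \in B :|: (Sr :\: Z)
                   & 0 < P s a s'].
Proof.
move=> ZSr /set0Pn[z zZ]; apply: contrapT => no_exit.
have P0 s a s' : s \in Z -> a \in conserving s -> s' \in B :|: (Sr :\: Z) -> P s a s' = 0.
  move=> sZ sa s'Z; apply/eqP; rewrite eq_le P_ge0 andbT leNgt; apply/negP => Pp.
  by apply: no_exit; exists s, a, s'.
(* [eta] lies below every positive shortfall, so a non-conserving action tolerates lowering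
   [value s] by [eta * value s], which is at most [eta]. *)
have [eta [eta_gt0 eta_le1 eta_le]] :=
  lower_bound_of_positives (fun i : S * A => shortfall i.1 i.2).
pose w s := if s \in Z then (1 - eta) * value s else value s.
have w_le s : w s <= value s.
  rewrite /w; case: ifP => // _; rewrite ler_piMl ?value_ge0//.
  by rewrite gerDl oppr_le0 ltW.
have : value z <= w z.
  apply: value_le_superharmonic; last exact: (fintype.subsetP ZSr).
    move=> s sr; rewrite /w; case: ifP => _; rewrite ?value_ge0//.
    by rewrite mulr_ge0 ?value_ge0// subr_ge0.
  move=> s a sr sa; have [sZ|sZ] := boolP (s \in Z); last first.
    rewrite {2}/w (negbTE sZ); apply: le_trans (lookahead_value_le sa).
    by apply: lookahead_mono.
  have [sc|snc] := boolP (a \in conserving s).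
    have vE : lookahead value s a = value s by move: sc; rewrite inE => /andP[_ /eqP].
    have e0 : exit_prob s a = 0.
      rewrite /exit_prob sr big1// => s' s'B; apply: P0 => //.
      by rewrite inE s'B.
    rewrite {2}/w sZ -vE /lookahead e0 !add0r /propagate mulr_sumr.
    apply: ler_sum => s' s'r; rewrite /w; case: ifPn => s'Z.
      by rewrite mulrCA.
    by rewrite P0 ?mul0r ?mulr0// !inE s'Z s'r orbT.
  have gap : eta <= shortfall s a.
    apply: (eta_le (s, a)) => /=; rewrite lt_neqAle shortfall_ge0// andbT eq_sym.
    by move: snc; rewrite inE sa /= subr_eq0 eq_sym.
  apply: (@le_trans _ _ (lookahead value s a)); first exact: lookahead_mono.
  rewrite /w sZ mulrBl mul1r lerBrDr -lerBrDl (le_trans _ gap)//.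
  by rewrite ler_piMr ?value_le1// ltW.
rewrite /w zZ leNgt => /negP; apply.
rewrite mulrBl mul1r ltrBlDr ltrDl mulr_gt0// value_gt0//.
exact: (fintype.subsetP ZSr).
Qed.

(** The uniform choice among all conserving actions; a single one per state might circulate in [Sr]
    forever. Where no action is conserving, division by 0 gives 0. *)
Definition blend (s : S) (a : A) : R := (a \in conserving s)%:R / #|conserving s|%:R.

Lemma blend_ge0 s a : 0 <= blend s a.
Proof. by rewrite divr_ge0 ?ler0n. Qed.

Lemma card_conserving_gt0 s : s \in Sr -> (0 < #|conserving s|)%N.
Proof.
move=> sr; have [a sa va] := value_conserving sr.
by apply/card_gt0P; exists a; rewrite inE sa va eqxx.
Qed.

Lemma blend_gt0 s a : a \in conserving s -> 0 < blend s a.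
Proof.
move=> sc; rewrite /blend sc divr_gt0 ?ltr0n//.
by apply/card_gt0P; exists a.
Qed.

Lemma blend_sum1 s : s \in Sr -> \sum_(a in av s) blend s a = 1.
Proof.
move=> sr; rewrite -mulr_suml -natr_sum.
rewrite (_ : (\sum_(a in av s) _)%N = #|conserving s|).
  by rewrite divff// pnatr_eq0 -lt0n card_conserving_gt0.
rewrite -sum1_card [RHS]big_mkcond [LHS]big_mkcond; apply: eq_bigr => a _.
by rewrite inE; case: (a \in av s); case: eqP.
Qed.

Lemma blend_shortfall s a : blend s a * shortfall s a = 0.
Proof.
rewrite /blend /shortfall inE; case: eqP => [->|_]; first by rewrite subrr mulr0.
by rewrite andbF !mul0r.
Qed.

Definition blend_chain (s s' : S) : R :=
  if (s \in Sr) && (s' \in Sr) then \sum_(a in av s) P s a s' * blend s a else 0.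

Lemma blend_chain_ge0 s s' : 0 <= blend_chain s s'.
Proof.
rewrite /blend_chain; case: ifP => // _; apply: sumr_ge0 => a _.
by rewrite mulr_ge0 ?blend_ge0.
Qed.

Lemma blend_chain_exit s : s \in Sr ->
  \sum_(a in av s) (\sum_(s' in B) P s a s') * blend s a + \sum_s' blend_chain s s' <= 1.
Proof.
move=> sr; rewrite -(blend_sum1 sr).
have -> : \sum_s' blend_chain s s'
    = \sum_(a in av s) (\sum_(s' in Sr) P s a s') * blend s a.
  under [RHS]eq_bigr do rewrite mulr_suml.
  rewrite [RHS]exchange_big [RHS]big_mkcond /=; apply: eq_bigr => s' _.
  by rewrite /blend_chain sr.
rewrite -big_split; apply: ler_sum => a sa /=; rewrite -mulrDl.
by rewrite ler_piMl ?blend_ge0 ?exit_remain_le1.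
Qed.

Lemma blend_chain_le1 s : \sum_s' blend_chain s s' <= 1.
Proof.
have [sr|sr] := boolP (s \in Sr).
  apply: le_trans (blend_chain_exit sr); rewrite lerDr sumr_ge0// => a _.
  by rewrite mulr_ge0 ?blend_ge0 ?sumr_ge0.
by rewrite big1 ?ler01// => s' _; rewrite /blend_chain (negbTE sr).
Qed.

(** The support [Z] of an invariant measure has an exit by a conserving action, which [blend] plays.
    An exit to [B] makes the total mass drop strictly; an exit to a state of [Sr] outside [Z] gives
    that state positive mass. *)
Lemma blend_chain_transient : transient blend_chain.
Proof.
move=> x x_ge0 xE s; apply/eqP/negP => xs0.
pose Z := [set u | x u != 0]%SET.
have [||u [a [u' [uZ ua u'Z Pu]]]] := @conserving_no_trap Z.
- apply/fintype.subsetP => u; rewrite inE; apply: contraNT => ur; rewrite xE.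
  by apply/eqP; rewrite big1// => t _; rewrite /blend_chain (negbTE ur) andbF mulr0.
- by apply/set0Pn; exists s; rewrite inE; apply/negP.
have sav : a \in av u by move: ua; rewrite inE => /andP[].
have xu : 0 < x u by rewrite lt_neqAle x_ge0 andbT eq_sym; rewrite inE in uZ.
have ur : u \in Sr.
  apply: contraLR uZ => ur; rewrite inE negbK xE.
  by apply/eqP; rewrite big1// => t _; rewrite /blend_chain (negbTE ur) andbF mulr0.
move: u'Z; rewrite !inE => /orP[u'B|/andP[]].
  have lt1 : \sum_s' blend_chain u s' < 1.
    apply: lt_le_trans (blend_chain_exit ur); rewrite ltrDr.
    rewrite (bigD1 a)//= ltr_wpDr ?sumr_ge0// => [b _|].
      by rewrite mulr_ge0 ?blend_ge0 ?sumr_ge0.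
    rewrite mulr_gt0 ?blend_gt0// (bigD1 u')//= ltr_wpDr// sumr_ge0//.
  have : \sum_t x t < \sum_t x t.
    rewrite {1}(eq_bigr _ (fun t _ => xE t)) sum_push1.
    rewrite (bigD1 u)//= [ltRHS](bigD1 u)//= ltr_leD//.
      by rewrite -[ltRHS]mulr1 ltr_pM2l.
    by apply: ler_sum => t _; rewrite ler_piMr// blend_chain_le1.
  by rewrite ltxx.
rewrite negbK => /eqP xu' u'r.
have := xE u'; rewrite xu' => /esym /psumr_eq0P.
move=> /(_ (fun t _ => mulr_ge0 (x_ge0 t) (blend_chain_ge0 t u'))) /(_ u isT) /eqP.
rewrite mulf_eq0 gt_eqF//= /blend_chain ur u'r /= => /eqP /psumr_eq0P.
move=> /(_ (fun b _ => mulr_ge0 (P_ge0 u b u') (blend_ge0 u b))) /(_ a sav) /eqP.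
by rewrite mulf_eq0 !gt_eqF// blend_gt0.
Qed.

(** * Truncated occupation measures of a policy *)

Variable s0 : S.
Hypothesis s0_Sr : s0 \in Sr.

Section one_policy.
Variable pol : nat -> S -> A -> R.
Hypothesis pol_ge0 : forall t s a, 0 <= pol t s a.
Hypothesis pol_sum1 : forall t s, \sum_(a in av s) pol t s a = 1.

(** Mass that has left [Sr] is not propagated, so a state outside [Sr] is charged only at the moment
    of arrival. *)
Fixpoint occ_at t (s : S) : R :=
  if t is u.+1 then
    \sum_(s' in Sr) \sum_(a in av s') P s' a s * (occ_at u s' * pol u s' a)
  else (s == s0)%:R.

Definition occ_upto n (s : S) (a : A) : R := \sum_(t < n) occ_at t s * pol t s a.

Lemma occ_at_ge0 t s : 0 <= occ_at t s.
Proof.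
elim: t s => [|t IH] s /=; first exact: ler0n.
by apply: sumr_ge0 => s' _; apply: sumr_ge0 => a _; rewrite !mulr_ge0.
Qed.

Lemma occ_upto_ge0 n s a : 0 <= occ_upto n s a.
Proof. by apply: sumr_ge0 => t _; rewrite mulr_ge0 ?occ_at_ge0. Qed.

(** The factor 1 gives the shape expected by [occ_sum_lin] and [net_outflow_lin]. *)
Lemma occ_uptoS n s a :
  occ_upto n.+1 s a = occ_upto n s a + 1 * (occ_at n s * pol n s a).
Proof. by rewrite /occ_upto big_ord_recr mul1r. Qed.

Lemma occ_sum_upto n f :
  occ_sum (occ_upto n) f = \sum_(t < n) occ_sum (fun s a => occ_at t s * pol t s a) f.
Proof.
elim: n => [|n IH].
  rewrite big_ord0 /occ_sum big1// => s _; rewrite big1// => a _.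
  by rewrite /occ_upto big_ord0 mul0r.
rewrite big_ord_recr -IH.
rewrite -[X in _ = _ + X]mul1r -occ_sum_lin.
by apply: eq_occ_sum => s a _ _; rewrite occ_uptoS.
Qed.

Lemma eq_net_outflow lam lam' s : (forall s a, lam s a = lam' s a) ->
  net_outflow lam s = net_outflow lam' s.
Proof.
move=> e; rewrite /net_outflow; rewrite (eq_bigr _ (fun a _ => e s a)); congr (_ - _).
by apply: eq_bigr => s' _; apply: eq_bigr => a _; rewrite e.
Qed.

(** Telescoping: the outflow of one stage is its mass minus that of the next, so truncation violates
    the flow constraint exactly by the mass at stage [n]. *)
Lemma net_outflow_upto n s :
  net_outflow (occ_upto n) s = (s == s0)%:R - occ_at n s.
Proof.
elim: n => [|n IH].
  rewrite subrr /net_outflow big1 => [|a _]; last by rewrite /occ_upto big_ord0.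
  rewrite big1 ?subrr// => s' _; rewrite big1// => a _.
  by rewrite /occ_upto big_ord0 mulr0.
rewrite (eq_net_outflow _ (occ_uptoS n)) net_outflow_lin IH mul1r.
by rewrite /net_outflow -mulr_sumr pol_sum1 mulr1 addrA subrK.
Qed.

Lemma occ_sum_upto_mono n m (f : S -> A -> R) :
  (forall s a, s \in Sr -> a \in av s -> 0 <= f s a) ->
  (n <= m)%N -> occ_sum (occ_upto n) f <= occ_sum (occ_upto m) f.
Proof.
move=> f_ge0 /subnK <-; elim: (m - n)%N => [|k IH]; first by rewrite add0n.
rewrite addSn (le_trans IH)// !occ_sum_upto big_ord_recr /= lerDl.
by apply: occ_sum_ge0 => // s a _ _; rewrite mulr_ge0 ?occ_at_ge0.
Qed.

(** Balance of value: the initial value is what has been collected, what the present mass can still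
    collect, and what was lost by non-conserving actions. It is [occ_sum_outflow] with [value] as
    potential. *)
Lemma exit_occ_upto n : occ_sum (occ_upto n) exit_prob
  + \sum_(s in Sr) occ_at n s * value s + occ_sum (occ_upto n) shortfall
  = value s0.
Proof.
have := occ_sum_outflow (occ_upto n) value.
under [X in _ = X -> _]eq_bigr do rewrite net_outflow_upto mulrBl.
rewrite sumrB (bigD1 s0)//= eqxx mul1r big1 ?addr0 => [|s /andP[_ /negbTE ->]]; last first.
  by rewrite mul0r.
rewrite (eq_occ_sum (lam' := occ_upto n)
  (f' := fun s a => exit_prob s a + shortfall s a)); last first.
  by move=> s a _ _; rewrite /shortfall /lookahead; congr (_ * _); ring.
by rewrite occ_sumD; lra.
Qed.

End one_policy.

(** * Feasible points and the lower bound for policies *)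

Definition feasible (x : R) (lam : S -> A -> R) :=
  [/\ occ_sum lam exit_prob = x,
      forall s, s \in Sr -> net_outflow lam s = (s == s0)%:R
    & forall s a, s \in Sr -> a \in av s -> 0 <= lam s a].

Lemma occ_sum_exit lam :
  (forall s, s \in Sr -> net_outflow lam s = (s == s0)%:R) ->
  occ_sum lam exit_prob + occ_sum lam shortfall = value s0.
Proof.
move=> lamE; have := occ_sum_outflow lam value.
rewrite (bigD1 s0)//= lamE// eqxx mul1r big1 ?addr0 => [|s /andP[sr /negbTE ss0]]; last first.
  by rewrite lamE// ss0 mul0r.
move=> <-; rewrite -occ_sumD; apply: eq_occ_sum => s a _ _.
by rewrite /shortfall /lookahead; congr (_ * _); ring.
Qed.

Lemma occ_sum_exit_le lam :
  (forall s, s \in Sr -> net_outflow lam s = (s == s0)%:R) ->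
  (forall s a, s \in Sr -> a \in av s -> 0 <= lam s a) ->
  occ_sum lam exit_prob <= value s0.
Proof.
move=> lamE lam_ge0; rewrite -(occ_sum_exit lamE) lerDl.
by apply: occ_sum_ge0 => // s a _; exact: shortfall_ge0.
Qed.

(** At stage [t] the rule plays a best action for the [n - t.+1] steps that follow. This realizes
    the iterates by actual policies. *)
Lemma greedy_policy n : exists sel : nat -> S -> A,
  (forall t s, sel t s \in av s) /\
  value_iter n s0 <= occ_sum (occ_upto (fun t s a => (a == sel t s)%:R) n) exit_prob.
Proof.
have /choice[sel selP] : forall ts : nat * S, exists a, a \in av ts.2 /\
    value_iter (n - ts.1.+1).+1 ts.2 = lookahead (value_iter (n - ts.1.+1)) ts.2 a.
  by move=> [t s]; have [a] := value_iter_best (n - t.+1) s; exists a.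
exists (fun t s => sel (t, s)); split => [t s|]; first by have [] := selP (t, s).
set pol := fun t s a => _.
have occ_sum_pol t f : occ_sum (fun s a => occ_at pol t s * pol t s a) f
    = \sum_(s in Sr) occ_at pol t s * f s (sel (t, s)).
  apply: eq_bigr => s _; rewrite (bigD1 (sel (t, s)))/=; last by have [] := selP (t, s).
  rewrite /pol eqxx mulr1 big1 ?addr0// => a /andP[_ /negbTE ->].
  by rewrite mulr0 mul0r.
(* Invariant: the reward collected in the first [k] stages plus the expected value of the [n - k]
   steps left. *)
suff H k : (k <= n)%N -> occ_sum (occ_upto pol k) exit_prob
    + \sum_(s in Sr) occ_at pol k s * value_iter (n - k) s = value_iter n s0.
  have := H n (leqnn n); rewrite subnn /= big1 => [|s _]; last by rewrite mulr0.
  by rewrite addr0 => ->.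
elim: k => [_|k IH kn].
  rewrite occ_sum_upto big_ord0 add0r subn0 (bigD1 s0)//= eqxx mul1r.
  by rewrite big1 ?addr0// => s /andP[_ /negbTE ->]; rewrite mul0r.
rewrite -(IH (ltnW kn)) !occ_sum_upto big_ord_recr /= -addrA; congr (_ + _).
rewrite occ_sum_pol -(subnSK kn).
under [RHS]eq_bigr => s _ do rewrite (selP (k, s)).2 mulrDr.
rewrite big_split; congr (_ + _) => /=.
under eq_bigr do rewrite mulr_suml.
rewrite exchange_big /=; apply: eq_bigr => s' _.
rewrite /propagate mulr_sumr; apply: eq_bigr => s _.
rewrite (bigD1 (sel (k, s')))/=; last by have [] := selP (k, s').
rewrite /pol eqxx mulr1 big1 ?addr0 => [|a /andP[_ /negbTE ->]]; first by ring.
by rewrite !mulr0.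
Qed.

(* Following [pol] for [n] steps and [blend] afterwards turns the truncated
   occupation measure into a feasible point, at a cost controlled by the value
   still to be collected. *)
Lemma optimal_cost_le_policy_cost (pol : nat -> S -> A -> R) (x vs ct : R)
    (c : S -> A -> R) :
  (forall t s a, 0 <= pol t s a) ->
  (forall t s, \sum_(a in av s) pol t s a = 1) ->
  (forall n, value_iter n s0 <= x) ->
  (forall y, (forall n, occ_sum (occ_upto pol n) exit_prob <= y) -> x <= y) ->
  (forall lam, feasible x lam -> vs <= occ_sum lam c) ->
  (forall n, occ_sum (occ_upto pol n) c <= ct) ->
  vs <= ct.
Proof.
move=> pol_ge0 pol_sum1 value_x x_sup vs_le ct_ge.
have vx : value s0 <= x by exact: value_le.
have occE n := exit_occ_upto pol_sum1 n.
have short_ge0 n : 0 <= occ_sum (occ_upto pol n) shortfall.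
  by apply: occ_sum_ge0 => s a _ sa; [exact: occ_upto_ge0|exact: shortfall_ge0].
have rest_ge0 n : 0 <= \sum_(s in Sr) occ_at pol n s * value s.
  by apply: sumr_ge0 => s _; rewrite mulr_ge0 ?value_ge0// occ_at_ge0.
(* Shortfall only accumulates: a positive amount by stage [n] would keep all collected rewards below
   [value s0] minus it, against [x_sup] and [value s0 <= x]. *)
have short0 n : occ_sum (occ_upto pol n) shortfall = 0.
  apply/eqP; rewrite eq_le short_ge0 andbT.
  suff : x <= value s0 - occ_sum (occ_upto pol n) shortfall by lra.
  apply: x_sup => m.
  have nm : occ_sum (occ_upto pol n) shortfall
      <= occ_sum (occ_upto pol (n + m)) shortfall.
    apply: occ_sum_upto_mono => //; last exact: leq_addr.
    by move=> s a _; exact: shortfall_ge0.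
  have mm : occ_sum (occ_upto pol m) exit_prob
      <= occ_sum (occ_upto pol (n + m)) exit_prob.
    apply: occ_sum_upto_mono => //; last exact: leq_addl.
    by move=> s a _ _; exact: exit_prob_ge0.
  by have := occE (n + m)%N; have := rest_ge0 (n + m)%N; lra.
have vxE : value s0 = x.
  apply/eqP; rewrite eq_le vx x_sup// => n.
  by have := occE n; have := rest_ge0 n; rewrite short0; lra.
(* [cb] is the expected cost of one step of [blend], and [h] below its total until the chain leaves
   [Sr]. *)
pose cb s := if s \in Sr then \sum_(a in av s) blend s a * c s a else 0.
have [h hE] := transient_cosolution blend_chain_ge0 blend_chain_le1
  blend_chain_transient cb.
(* As [value] is positive on [Sr], the future cost [h] is at most a constant times the value still
   to be collected. *)
pose K := 1 + \sum_(s in Sr) `|h s| / value s.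
have K_gt0 : 0 < K.
  by rewrite ltr_pwDl// sumr_ge0// => s sr; rewrite divr_ge0// value_ge0.
have hK s : s \in Sr -> h s <= K * value s.
  move=> sr; rewrite -ler_pdivrMr ?value_gt0//.
  apply: (@le_trans _ _ (`|h s| / value s)).
    by rewrite ler_pM2r ?invr_gt0 ?value_gt0// ler_norm.
  rewrite /K (bigD1 s)//= addrCA lerDl addr_ge0// sumr_ge0// => u /andP[ur _].
  by rewrite divr_ge0// value_ge0.
have bound n : vs <= ct + K * (x - occ_sum (occ_upto pol n) exit_prob).
  pose a s := if s \in Sr then occ_at pol n s else 0.
  (* [mu] is the total occupation of the blended chain started from the mass at stage [n]; adding it
     restores the flow balance broken by truncation. *)
  have [mu muE] := transient_solution blend_chain_ge0 blend_chain_le1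
    blend_chain_transient a.
  have mu_ge0 : forall s, 0 <= mu s.
    apply: (transient_solution_ge0 blend_chain_ge0 blend_chain_le1
      blend_chain_transient _ muE) => s.
    by rewrite /a; case: ifP => // _; exact: occ_at_ge0.
  pose lam s b := occ_upto pol n s b + 1 * (mu s * blend s b).
  have flow s : s \in Sr -> net_outflow lam s = (s == s0)%:R.
    move=> sr; rewrite net_outflow_lin net_outflow_upto// mul1r.
    suff -> : net_outflow (fun s b => mu s * blend s b) s = occ_at pol n s by rewrite subrK.
    rewrite /net_outflow -mulr_sumr blend_sum1// mulr1 {1}muE /a sr.
    rewrite (_ : \sum_(s' in Sr) _ = \sum_u mu u * blend_chain u s) ?addrK//.
    rewrite big_mkcond; apply: eq_bigr => u _; rewrite /blend_chain sr andbT.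
    case: ifP => _; last by rewrite mulr0.
    by rewrite mulr_sumr; apply: eq_bigr => b _; rewrite mulrCA.
  have lam_ge0 s b : s \in Sr -> b \in av s -> 0 <= lam s b.
    by move=> _ _; rewrite addr_ge0 ?occ_upto_ge0// mul1r mulr_ge0 ?blend_ge0.
  have lam_short : occ_sum lam shortfall = 0.
    rewrite occ_sum_lin short0 mul1r add0r /occ_sum big1// => s _.
    by rewrite big1// => b _; rewrite -mulrA blend_shortfall mulr0.
  have lam_feas : feasible x lam.
    by split => //; have := occ_sum_exit flow; rewrite lam_short addr0 vxE.
  apply: le_trans (vs_le _ lam_feas) _.
  rewrite occ_sum_lin lerD ?ct_ge// mul1r.
  have -> : occ_sum (fun s b => mu s * blend s b) c = \sum_s mu s * cb s.
    rewrite /occ_sum big_mkcond; apply: eq_bigr => s _; rewrite /cb.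
    case: ifP => _; last by rewrite mulr0.
    by rewrite mulr_sumr; apply: eq_bigr => b _; rewrite mulrA.
  (* The cost of the continuation becomes the mass at stage [n] paired with [h]; by [exit_occ_upto]
     without shortfall, the same mass paired with [value] is [x] minus the reward collected. *)
  rewrite (transient_pairing muE hE).
  have := occE n; rewrite short0 addr0 vxE => <-.
  rewrite [_ + \sum_(s in Sr) _]addrC addrK mulr_sumr [leRHS]big_mkcond.
  apply: ler_sum => s _; rewrite /a; case: ifP => sr; last by rewrite mul0r.
  by rewrite mulrCA ler_wpM2l ?occ_at_ge0 ?hK.
(* By [bound], a gap [vs - ct > 0] would keep every collected reward at least [(vs - ct) / K] below
   [x]. *)
suff : x <= x - (vs - ct) / K.
  by rewrite lerBrDl -lerBrDr subrr pmulr_lle0 ?invr_gt0// subr_le0.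
apply: x_sup => n; rewrite lerBrDr -lerBrDl ler_pdivrMr// mulrC.
by have := bound n; lra.
Qed.

(** * Deterministic selection from the support of an optimal point *)

Section selection.
Variables (c lam : S -> A -> R) (x vs : R) (sel : S -> A) (d : S -> A -> R).
Hypothesis c_ge0 : forall s a, s \in Sr -> a \in av s -> 0 <= c s a.
Hypothesis value_x : forall n, value_iter n s0 <= x.
Hypothesis lam_feasible : feasible x lam.
Hypothesis lam_cost : occ_sum lam c = vs.
Hypothesis vs_le : forall mu, feasible x mu -> vs <= occ_sum mu c.
Hypothesis lam_shortest : forall mu, feasible x mu -> occ_sum mu c = vs ->
  occ_sum lam (fun _ _ => 1) <= occ_sum mu (fun _ _ => 1).

Definition occupied : {set S} := [set s in Sr | [exists a in av s, 0 < lam s a]]%SET.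

Hypothesis sel_av : forall s, s \in occupied -> sel s \in av s.
Hypothesis lam_sel_gt0 : forall s, s \in occupied -> 0 < lam s (sel s).
Hypothesis d_sel : forall s a, s \in occupied -> d s a = (a == sel s)%:R.

Let occupied_Sr s : s \in occupied -> s \in Sr.
Proof. by rewrite inE => /andP[]. Qed.

Let lam_ge0 s a : s \in Sr -> a \in av s -> 0 <= lam s a.
Proof. by case: lam_feasible => _ _; exact. Qed.

Let unoccupied0 s a : s \in Sr -> s \notin occupied -> a \in av s -> lam s a = 0.
Proof.
move=> sr sT sa; apply/eqP; rewrite eq_le lam_ge0// andbT leNgt.
apply: contra sT => pos; rewrite inE sr /=.
by apply/existsP; exists a; rewrite sa.
Qed.

Let inflow_eq0 s : s \in Sr -> s \notin occupied ->
  (s == s0)%:R + \sum_(s' in Sr) \sum_(a in av s') P s' a s * lam s' a = 0.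
Proof.
move=> sr sT; case: lam_feasible => _ /(_ s sr) <- _.
by rewrite /net_outflow subrK big1// => a sa; rewrite unoccupied0.
Qed.

Let inflow_ge0 s : 0 <= \sum_(s' in Sr) \sum_(a in av s') P s' a s * lam s' a.
Proof.
apply: sumr_ge0 => s' sr; apply: sumr_ge0 => a sa.
by rewrite mulr_ge0 ?lam_ge0.
Qed.

Lemma init_occupied : s0 \in occupied.
Proof.
apply/negPn/negP => /(inflow_eq0 s0_Sr); rewrite eqxx /=.
by have /= := inflow_ge0 s0; lra.
Qed.

(** An unoccupied state of [Sr] has zero inflow by the flow constraint, while every selected pair
    carries positive [lam]. *)
Lemma occupied_closed s s' : s \in occupied -> s' \in Sr -> s' \notin occupied ->
  P s (sel s) s' = 0.
Proof.
move=> sT s'r s'T; have := inflow_eq0 s'r s'T.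
have -> : (s' == s0) = false by apply: contraNF s'T => /eqP ->; exact: init_occupied.
rewrite add0r => /psumr_eq0P H.
have {H} /psumr_eq0P : \sum_(a in av s) P s a s' * lam s a = 0.
  apply: H; last exact: occupied_Sr.
  by move=> u ur; apply: sumr_ge0 => a ua; rewrite mulr_ge0 ?lam_ge0.
move=> /(_ (fun a sa => mulr_ge0 (P_ge0 s a s') (lam_ge0 (occupied_Sr sT) sa))).
move=> /(_ _ (sel_av sT)) /eqP.
by rewrite mulf_eq0 (gt_eqF (lam_sel_gt0 sT)) orbF => /eqP.
Qed.

Definition sel_chain (s s' : S) : R :=
  if (s \in occupied) && (s' \in occupied) then P s (sel s) s' else 0.

Lemma sel_chain_ge0 s s' : 0 <= sel_chain s s'.
Proof. by rewrite /sel_chain; case: ifP. Qed.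

Lemma sel_chain_le1 s : \sum_s' sel_chain s s' <= 1.
Proof.
rewrite /sel_chain; have [sT|sT] := boolP (s \in occupied); last first.
  by rewrite big1 ?ler01.
rewrite -(P_sum1 (sel_av sT)); apply: ler_sum => s' _ /=.
by case: ifP.
Qed.

Definition along (rho : S -> R) (s : S) (a : A) : R := rho s * (a == sel s)%:R.

Section along.
Variable rho : S -> R.
Hypothesis rho_ge0 : forall s, 0 <= rho s.
Hypothesis rho_supp : forall s, s \notin occupied -> rho s = 0.

Lemma sum_along s (f : A -> R) :
  \sum_(a in av s) along rho s a * f a = rho s * f (sel s).
Proof.
have [sT|sT] := boolP (s \in occupied); last first.
  by rewrite big1 => [|a _]; rewrite /along rho_supp// !mul0r.
rewrite (bigD1 (sel s)) ?sel_av//= /along eqxx mulr1 big1 ?addr0// => a /andP[_ /negbTE ->].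
by rewrite mulr0 mul0r.
Qed.

Lemma occ_sum_along f : occ_sum (along rho) f = \sum_(s in Sr) rho s * f s (sel s).
Proof. by apply: eq_bigr => s _; exact: sum_along. Qed.

(** By [occupied_closed], restricting the chain to occupied states discards no flow into [Sr]. *)
Lemma net_outflow_along s : s \in Sr ->
  net_outflow (along rho) s = rho s - \sum_s' rho s' * sel_chain s' s.
Proof.
move=> sr; rewrite /net_outflow; congr (_ - _).
  by rewrite -[RHS]mulr1 -(sum_along s (fun=> 1)); apply: eq_bigr => a _; rewrite mulr1.
rewrite big_mkcond; apply: eq_bigr => s' _.
have [s'T|s'T] := boolP (s' \in occupied); last first.
  rewrite rho_supp// mul0r; case: ifP => // _; rewrite big1// => a _.
  by rewrite /along rho_supp// mul0r mulr0.
rewrite occupied_Sr//; under eq_bigr do rewrite mulrC.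
rewrite sum_along /sel_chain s'T /=; case: ifPn => // sT.
by rewrite occupied_closed.
Qed.

(** [lam] is positive on the finitely many pairs charged by [along rho], so a small multiple fits
    below it. The divisor [1 + rho s] avoids division by 0. *)
Lemma along_below : exists2 eta : R, 0 < eta &
  forall s a, s \in Sr -> a \in av s -> 0 <= lam s a + - eta * along rho s a.
Proof.
have [eta [eta_gt0 _ eta_le]] :=
  lower_bound_of_positives (fun s => lam s (sel s) / (1 + rho s)).
exists eta => // s a sr sa; rewrite /along.
have [sT|sT] := boolP (s \in occupied); last first.
  by rewrite rho_supp// mul0r mulr0 addr0 lam_ge0.
case: eqP => [->|_]; last by rewrite !mulr0 addr0 lam_ge0.
have rho1 : 0 < 1 + rho s by rewrite ltr_pwDl.
have : eta <= lam s (sel s) / (1 + rho s) by rewrite eta_le// divr_gt0// lam_sel_gt0.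
rewrite ler_pdivlMr// => h; rewrite mulr1 mulNr subr_ge0 (le_trans _ h)//.
by rewrite ler_wpM2l ?lerDr// ltW.
Qed.

End along.

Lemma feasible_shift (eta : R) (mu : S -> A -> R) :
  (forall s a, s \in Sr -> a \in av s -> 0 <= lam s a + eta * mu s a) ->
  (forall s, s \in Sr -> net_outflow mu s = 0) -> occ_sum mu exit_prob = 0 ->
  feasible x (fun s a => lam s a + eta * mu s a).
Proof.
move=> ge0 flow0 exit0; case: lam_feasible => lam_x lam_flow _; split => // [|s sr].
  by rewrite occ_sum_lin exit0 mulr0 addr0.
by rewrite net_outflow_lin flow0// mulr0 addr0 lam_flow.
Qed.

(* An invariant measure of the selected chain is a circulation; subtracting it
   from [lam] costs nothing and shortens [lam]. *)
Lemma sel_chain_transient : transient sel_chain.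
Proof.
move=> rho rho_ge0 rhoE.
have rho_supp s : s \notin occupied -> rho s = 0.
  move=> sT; rewrite rhoE big1// => u _.
  by rewrite /sel_chain (negbTE sT) andbF mulr0.
have [eta eta_gt0 ge0] := along_below rho_ge0 rho_supp.
have flow0 s : s \in Sr -> net_outflow (along rho) s = 0.
  by move=> sr; rewrite net_outflow_along// -rhoE subrr.
have along_ge0 s a : 0 <= along rho s a by rewrite mulr_ge0.
(* Pairing a circulation with the potential [value] gives 0, which splits into two nonnegative
   sums. *)
have exit0 : occ_sum (along rho) exit_prob = 0.
  have := occ_sum_outflow (along rho) value.
  rewrite [X in _ = X -> _]big1 => [|s sr]; last by rewrite flow0// mul0r.
  rewrite (eq_occ_sum (lam' := along rho)
    (f' := fun s a => exit_prob s a + shortfall s a)); last first.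
    by move=> s a _ _; rewrite /shortfall /lookahead; congr (_ * _); ring.
  rewrite occ_sumD => /eqP; rewrite paddr_eq0.
  - by move=> /andP[/eqP].
  - by apply: occ_sum_ge0 => // s a _ _; exact: exit_prob_ge0.
  - by apply: occ_sum_ge0 => // s a _; exact: shortfall_ge0.
have feas := feasible_shift ge0 flow0 exit0.
have cost_ge0 : 0 <= occ_sum (along rho) c by exact: occ_sum_ge0.
(* Costs are nonnegative and [vs] is minimal, so removing the circulation keeps the cost;
   [lam_shortest] then leaves it no mass. *)
have costE : occ_sum (fun s a => lam s a + - eta * along rho s a) c = vs.
  apply/eqP; rewrite eq_le vs_le// andbT occ_sum_lin lam_cost gerDl mulNr oppr_le0.
  by rewrite mulr_ge0// ltW.
have := lam_shortest feas costE; rewrite occ_sum_lin lerDl mulNr oppr_ge0.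
rewrite pmulr_rle0// occ_sum_along// => sum_le0 s.
have [sT|/rho_supp//] := boolP (s \in occupied).
have : \sum_(s in Sr) rho s * 1 = 0.
  by apply/eqP; rewrite eq_le sum_le0 sumr_ge0// => u _; rewrite mulr1.
move=> /psumr_eq0P H; rewrite -[LHS]mulr1 H ?occupied_Sr// => u _.
by rewrite mulr1.
Qed.

Lemma occ_at_unoccupied t s : s \in Sr -> s \notin occupied ->
  occ_at (fun=> d) t s = 0.
Proof.
elim: t s => [|t IH] s sr sT /=.
  by case: eqP sT => // ->; rewrite init_occupied.
rewrite big1// => u ur; rewrite big1// => a ua.
have [uT|uT] := boolP (u \in occupied); last by rewrite IH// mul0r mulr0.
rewrite d_sel//; case: eqP => [->|_]; last by rewrite !mulr0.
by rewrite occupied_closed// mul0r.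
Qed.

(** Within [Sr] the rule [d] never meets an unoccupied state, so its partial occupations follow
    [sel_chain], whose transience yields the finite limit [mu]. *)
Lemma selection_occupation : exists mu : S -> R,
  [/\ forall s, 0 <= mu s,
      forall s, s \notin occupied -> mu s = 0,
      forall s, mu s = (s == s0)%:R + \sum_u mu u * sel_chain u s
    & forall f, (fun n => occ_sum (occ_upto (fun=> d) n) f) @ \oo
                --> occ_sum (along mu) f].
Proof.
pose a s : R := (s == s0)%:R.
have [mu muE] := transient_solution sel_chain_ge0 sel_chain_le1 sel_chain_transient a.
have mu_ge0 : forall s, 0 <= mu s.
  exact: (transient_solution_ge0 sel_chain_ge0 sel_chain_le1 sel_chain_transient _ muE).
have mu_supp s : s \notin occupied -> mu s = 0.
  move=> sT; rewrite muE /a big1 ?addr0.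
    by case: eqP sT => // ->; rewrite init_occupied.
  by move=> u _; rewrite /sel_chain (negbTE sT) andbF mulr0.
(* [occ_at] also records arrivals outside [Sr]; the restriction removes them, as [mu] vanishes
   there. *)
pose L n s := if s \in occupied then \sum_(t < n) occ_at (fun=> d) t s else 0.
have L_cvg : forall s, L ^~ s @ \oo --> mu s.
  apply: (transient_occupation_cvg sel_chain_ge0 sel_chain_le1
    sel_chain_transient _ muE) => //.
    by move=> s; rewrite /L big_ord0 if_same.
  move=> n s; rewrite {1}/L; case: ifPn => sT; last first.
    rewrite big1 ?addr0 => [|u _]; last by rewrite /sel_chain (negbTE sT) andbF mulr0.
    by rewrite /a; case: eqP sT => // ->; rewrite init_occupied.
  rewrite big_ord_recl; congr (_ + _) => /=.
  rewrite exchange_big [LHS]big_mkcond; apply: eq_bigr => u _ /=.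
  rewrite /L /sel_chain sT andbT; have [uT|uT] := boolP (u \in occupied); last first.
    rewrite mul0r; case: ifP => // ur; rewrite big1// => t _; rewrite big1// => b _.
    by rewrite occ_at_unoccupied// mul0r mulr0.
  rewrite occupied_Sr// mulr_suml; apply: eq_bigr => t _.
  rewrite (bigD1 (sel u)) ?sel_av//= d_sel// eqxx mulr1 mulrC big1 ?addr0// => b.
  by rewrite d_sel// => /andP[_ /negbTE ->]; rewrite !mulr0.
exists mu; split => // f.
have -> : (fun n => occ_sum (occ_upto (fun=> d) n) f)
    = (fun n => \sum_(s in Sr) L n s * f s (sel s)).
  apply/funext => n; apply: eq_bigr => s sr.
  rewrite /L; case: ifPn => sT; last first.
    rewrite mul0r big1// => b _; rewrite /occ_upto big1 ?mul0r// => t _.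
    by rewrite occ_at_unoccupied// mul0r.
  rewrite (bigD1 (sel s)) ?sel_av//=.
  have -> : occ_upto (fun=> d) n s (sel s) = \sum_(t < n) occ_at (fun=> d) t s.
    by apply: eq_bigr => t _; rewrite d_sel// eqxx mulr1.
  rewrite [X in _ + X]big1 ?addr0// => b /andP[_ /negbTE bs].
  by rewrite /occ_upto big1 ?mul0r// => t _; rewrite d_sel// bs mulr0.
rewrite occ_sum_along//; apply: cvg_big => [|s _]; first exact: add_continuous.
by apply: cvgM; [exact: L_cvg|exact: cvg_cst].
Qed.

(** [lam] is a mean, with positive weights, of [along mu] and [lam2]. Both collect at most
    [value s0 <= x] while [lam] collects [x], so [along mu] collects [x] too. Then [lam2] is
    feasible, and minimality of the cost at [lam] bounds the cost of [along mu]. *)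
Lemma selection_optimal : exists2 v : R, v <= vs
  & (fun n => occ_sum (occ_upto (fun=> d) n) exit_prob) @ \oo --> x
    /\ (fun n => occ_sum (occ_upto (fun=> d) n) c) @ \oo --> v.
Proof.
have [mu [mu_ge0 mu_supp muE mu_cvg]] := selection_occupation.
have [eta eta_gt0 eta_ge0] := along_below mu_ge0 mu_supp.
have [lam_x lam_flow _] := lam_feasible.
have flow s : s \in Sr -> net_outflow (along mu) s = (s == s0)%:R.
  by move=> sr; rewrite net_outflow_along// {1}muE addrK.
have along_ge0 s a : 0 <= along mu s a by rewrite mulr_ge0.
have vx : value s0 <= x by exact: value_le.
pose lam2 s a := lam s a + eta * (lam s a + -1 * along mu s a).
have lam2_ge0 s a : s \in Sr -> a \in av s -> 0 <= lam2 s a.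
  move=> sr sa; have := eta_ge0 s a sr sa; have := lam_ge0 sr sa; rewrite /lam2 => h1 h2.
  have := mulr_ge0 (ltW eta_gt0) h1; lra.
have lam2_flow s : s \in Sr -> net_outflow lam2 s = (s == s0)%:R.
  move=> sr; rewrite net_outflow_lin net_outflow_lin lam_flow// flow//.
  by rewrite mulN1r subrr mulr0 addr0.
have lam2E f : occ_sum lam2 f
    = occ_sum lam f + eta * (occ_sum lam f - occ_sum (along mu) f).
  by rewrite occ_sum_lin occ_sum_lin mulN1r.
have exitE : occ_sum (along mu) exit_prob = x.
  have le1 : occ_sum (along mu) exit_prob <= value s0 by exact: occ_sum_exit_le.
  have := occ_sum_exit_le lam2_flow lam2_ge0; rewrite lam2E lam_x => le2.
  apply/eqP; rewrite eq_le (le_trans le1 vx)/= -subr_le0 -(pmulr_rle0 _ eta_gt0).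
  by lra.
exists (occ_sum (along mu) c); last by split; rewrite -?exitE; exact: mu_cvg.
have : vs <= occ_sum lam2 c.
  by apply: vs_le; split => //; rewrite lam2E lam_x exitE subrr mulr0 addr0.
by rewrite lam2E lam_cost lerDl pmulr_rge0// subr_ge0.
Qed.

End selection.

End transient_occupation.

(** * The expanded process *)

Section unreaching.
Variables (R : realType) (M : labelled_mdp R) (p : AP M).

Lemma marginal_avail (M' : mdp R) (pi : policy M') s t x :
  x.2 \notin avail x.1 -> marginal pi s t x = 0.
Proof.
move=> xna; case: t => [|t]; first by rewrite marginal0 dr_avail// mulr0.
rewrite marginalS big1// => y _.
by rewrite /kernel [pi _ _ _]dr_avail// mulr0 mul0r.
Qed.

Definition point_rule (M' : mdp R) (sel : state M' -> action M')
    (sel_av : forall s, sel s \in avail s) : decision_rule M'.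
Proof.
exists (fun s a => (a == sel s)%:R) => [s a|s a|s]; first exact: ler0n.
  by case: eqP => [->|//]; rewrite sel_av.
rewrite (bigD1 (sel s))//= eqxx big1 ?addr0// => a /andP[_ /negbTE ->//].
Defined.

Lemma unreaching_marginal s (pi : policy M) t x :
  s \in unreaching p -> x.1 \in target p -> marginal pi s t x = 0.
Proof.
rewrite inE => /asboolP /(_ pi) reach0 xB.
have := le_reach_prob pi s (target p) t; rewrite reach0 lee_fin => le0.
apply: (psumr_eq0P (P := fun x => x.1 \in target p) (F := marginal pi s t)) => //.
  by move=> y _; exact: marginal_ge0.
by apply/eqP; rewrite eq_le le0 sumr_ge0// => y _; exact: marginal_ge0.
Qed.

Lemma target_unreaching s : s \in target p -> s \notin unreaching p.
Proof.
move=> sB; apply/negP => sU.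
pose pi : policy M := fun=> point_rule (@act0P R M).
have := @unreaching_marginal s pi 0%N (s, act0 s) sU sB.
by rewrite marginal0 /= !eqxx mulr1 => /eqP; rewrite oner_eq0.
Qed.

Lemma mem_remaining s :
  (s \in remaining p) = (s \notin target p) && (s \notin unreaching p).
Proof. by rewrite finset.in_setC finset.in_setU negb_or. Qed.

Definition delay (d : decision_rule M) (pi : policy M) : policy M :=
  fun t => if t is u.+1 then pi u else d.

(** The left side keeps only the paths that start with [a] and move to [s']. *)
Lemma marginal_delay (d : decision_rule M) (pi : policy M) s a s' t x :
  trans s a s' * d s a * marginal pi s' t x <= marginal (delay d pi) s t.+1 x.
Proof.
elim: t x => [|t IH] x; rewrite marginalS.
  rewrite (bigD1 (s, a))//= marginal0 marginal0 /kernel /= eqxx mul1r.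
  apply: ler_wpDr.
    apply: sumr_ge0 => y _; rewrite mulr_ge0 ?marginal_ge0// mulr_ge0 ?dr_ge0//.
    by have /andP[] := trans01 y.1 y.2 x.1.
  case: (eqVneq x.1 s') => [->|_].
    by rewrite mul1r le_eqVlt; apply/orP; left; apply/eqP; ring.
  rewrite mul0r mulr0 mulr_ge0 ?dr_ge0// mulr_ge0 ?dr_ge0//.
  by have /andP[] := trans01 s a x.1.
rewrite marginalS mulr_sumr; apply: ler_sum => y _.
rewrite mulrCA; apply: ler_pM => //.
  rewrite mulr_ge0 ?dr_ge0//.
  by have /andP[] := trans01 y.1 y.2 x.1.
by rewrite !mulr_ge0 ?dr_ge0 ?marginal_ge0//; have /andP[] := trans01 s a s'.
Qed.

(** A policy reaching the target from [s'] would, played after [a], reach it from [s]. *)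
Lemma unreaching_closed s a s' : s \in unreaching p -> a \in avail s ->
  0 < trans s a s' -> s' \in unreaching p.
Proof.
move=> sU sa tr; rewrite inE; apply/asboolP => pi; apply: reach_prob_eq0 => t x xB.
pose sel u := if u == s then a else act0 u.
have sel_av u : sel u \in avail u.
  by rewrite /sel; case: eqP => [->//|_]; exact: act0P.
have := marginal_delay (point_rule sel_av) pi s a s' t x.
rewrite (unreaching_marginal _ _ sU)//= /sel !eqxx mulr1 pmulr_rle0// => le0.
by apply/eqP; rewrite eq_le le0 marginal_ge0.
Qed.

End unreaching.

(** * Trajectory measures of the expanded MDP as occupation sums *)

Section expanded_process.
Variables (R : realType) (M : labelled_mdp R) (p : AP M).
Variables (N : nat) (N_gt0 : (0 < N)%N).
Local Notation S := (state M * 'I_N)%type.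
Local Notation Mbar := (expanded M N_gt0).
Local Notation Mabs := (expanded_absorbing p N_gt0).
Local Notation Sr := (lift_set N_gt0 (remaining p)).
Local Notation B := (lift_set N_gt0 (target p)).
Local Notation absorbed := (B :|: lift_set N_gt0 (unreaching p)).
Local Notation av := (fun s : S => avail s.1).
Local Notation P := (@expanded_trans R M N).

Lemma expanded_trans_ge0 s a s' : 0 <= P s a s'.
Proof. by have /andP[] := expanded_trans01 s a s'. Qed.

Lemma mem_lift_set (C : {set state M}) (s : S) :
  (s \in lift_set N_gt0 C) = (s.1 \in C).
Proof. by rewrite finset.inE. Qed.

Lemma target_not_remaining s : s \in B -> s \notin Sr.
Proof. by rewrite !mem_lift_set mem_remaining => ->. Qed.

Lemma not_remaining s : (s \notin Sr) = (s \in B :|: lift_set N_gt0 (unreaching p)).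
Proof. by rewrite finset.in_setU !mem_lift_set mem_remaining negb_and !negbK. Qed.

Lemma next_stage_exists (i : 'I_N) : exists j : 'I_N, next_stage i j.
Proof.
have := ltn_ord i; rewrite leq_eqVlt => /orP[/eqP iN|iN].
  by exists (Ordinal N_gt0); rewrite /next_stage /= iN !eqxx orbT.
by exists (Ordinal iN); rewrite /next_stage /= iN eqxx.
Qed.

(** Without an exit from [Z], no policy of [M] started at the first component of a point of [Z]
    meets the target, so that component would be unreaching. *)
Lemma remaining_no_trap (Z : {set S}) : Z \subset Sr -> Z != finset.set0 ->
  exists s a s', [/\ s \in Z, a \in avail s.1, s' \in B :|: (Sr :\: Z) & 0 < P s a s'].
Proof.
move=> ZSr /set0Pn[[s i] sZ]; apply: contrapT => no_exit.
have sU : s \notin unreaching p.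
  by have := fintype.subsetP ZSr _ sZ; rewrite mem_lift_set mem_remaining => /andP[].
move: sU; rewrite finset.inE => /asboolP; apply => pi; apply: reach_prob_eq0.
(* Policies of [M] carry no stage counter, so membership in [Z] is tracked up to some stage [j]. *)
suff H t x : 0 < marginal pi s t x ->
    x.1 \in unreaching p \/ exists j, (x.1, j) \in Z.
  move=> t x xB; apply/eqP; rewrite eq_le marginal_ge0 andbT leNgt; apply/negP.
  move=> /H[|[j xZ]]; first exact/negP/target_unreaching.
  by have := fintype.subsetP ZSr _ xZ; rewrite mem_lift_set mem_remaining xB.
elim: t x => [|t IH] y.
  rewrite marginal0; case: eqP => [->|_]; last by rewrite mul0r ltxx.
  by move=> _; right; exists i.
rewrite marginalS => sum_gt0.
have [x] : exists x, 0 < kernel pi t x y * marginal pi s t x.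
  apply: contrapT => none; move: sum_gt0; rewrite big1 ?ltxx// => x _.
  apply/eqP; rewrite eq_le; apply/andP; split.
    by rewrite leNgt; apply/negP => pos; apply: none; exists x.
  rewrite mulr_ge0 ?marginal_ge0// mulr_ge0 ?dr_ge0//.
  by have /andP[] := trans01 x.1 x.2 y.1.
rewrite /kernel; have mx := marginal_ge0 pi s t x.
have tr : 0 <= trans x.1 x.2 y.1 by have /andP[] := trans01 x.1 x.2 y.1.
have [xa|xna] := boolP (x.2 \in avail x.1); last first.
  by rewrite marginal_avail// mulr0 ltxx.
move: mx; rewrite le_eqVlt => /orP[/eqP <-|mx]; first by rewrite mulr0 ltxx.
move: tr; rewrite le_eqVlt => /orP[/eqP <-|tr]; first by rewrite !mul0r ltxx.
move=> _; case: (IH _ mx) => [xU|[j xZ]]; first by left; exact: unreaching_closed tr.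
have [k jk] := next_stage_exists j.
have [yU|yU] := boolP (y.1 \in unreaching p); first by left.
right; exists k; apply: contrapT => /negP ykZ; apply: no_exit.
exists (x.1, j), x.2, (y.1, k); split => //; last by rewrite /expanded_trans /= jk.
rewrite finset.in_setU finset.in_setD !mem_lift_set mem_remaining ykZ yU andbT.
by rewrite orbN.
Qed.

Section policy.
Variable pi : policy Mabs.
Let pol t (s : S) (a : action M) : R := pi t s a.
Local Notation s0 := (init Mabs).
Local Notation occ := (@occ_at R S (action M) Sr av P s0 pol).
Local Notation occ_upto := (@occ_upto R S (action M) Sr av P s0 pol).
Local Notation occ_sum := (@occ_sum R S (action M) Sr av).

(** Absorbed states never return to [Sr], so summing over predecessors in [Sr] misses nothing. *)
Lemma marginal_occ t s a : s \in Sr -> marginal pi s0 t (s, a) = occ t s * pol t s a.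
Proof.
elim: t s a => [|t IH] s a sr; first by rewrite marginal0.
rewrite marginalS /= /kernel /=.
rewrite (eq_bigr (fun x => (absorbing_trans absorbed x.1 x.2 s
  * marginal pi s0 t x) * pol t.+1 s a)) => [|x _]; last by rewrite mulrAC.
rewrite -mulr_suml; congr (_ * _).
rewrite (eq_bigr (fun x => (fun u b => absorbing_trans absorbed u b s
  * marginal pi s0 t (u, b)) x.1 x.2)) => [|[]//].
rewrite -(pair_big predT predT (fun u b => absorbing_trans absorbed u b s
  * marginal pi s0 t (u, b)))/=.
rewrite [RHS]big_mkcond; apply: eq_bigr => u _; case: ifPn => ur; last first.
  rewrite big1// => b _; rewrite /absorbing_trans -not_remaining ur.
  by case: eqP ur => [<-|_ _]; rewrite ?sr// mul0r.
rewrite [RHS]big_mkcond; apply: eq_bigr => b _; case: ifPn => ub; last first.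
  by rewrite marginal_avail// mulr0.
by rewrite /absorbing_trans -not_remaining ur /= IH.
Qed.

Lemma sum_marginal_occ t (f : S -> action M -> R) :
  (forall s a, s \notin Sr -> f s a = 0) ->
  \sum_(x : S * action M) marginal pi s0 t x * f x.1 x.2
  = occ_sum (fun s a => occ t s * pol t s a) f.
Proof.
move=> f0.
rewrite (eq_bigr (fun x => (fun u b => marginal pi s0 t (u, b) * f u b) x.1 x.2)) => [|[]//].
rewrite -(pair_big predT predT (fun u b => marginal pi s0 t (u, b) * f u b))/=.
rewrite [RHS]big_mkcond; apply: eq_bigr => u _; case: ifPn => ur; last first.
  by rewrite big1// => b _; rewrite f0 ?mulr0.
rewrite [RHS]big_mkcond; apply: eq_bigr => b _; case: ifPn => ub; last first.
  by rewrite marginal_avail// mul0r.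
by rewrite marginal_occ.
Qed.

Lemma expected_total_occ (f : S -> action M -> R) :
  (forall s a, 0 <= f s a) -> (forall s a, s \notin Sr -> f s a = 0) ->
  expected_total pi s0 f = limn (fun n => (occ_sum (occ_upto n) f)%:E).
Proof.
move=> f_ge0 f0; rewrite expected_totalE//; congr (limn _); apply/funext => n.
rewrite occ_sum_upto big_mkord sumEFin; congr (_%:E).
by apply: eq_bigr => t _; rewrite sum_marginal_occ.
Qed.

(** As [B] is absorbing, the probability of being in [B] at stage [n] dominates all that entered
    before. *)
Lemma exit_occ_le_reach n :
  ((occ_sum (occ_upto n) (exit_prob Sr B P))%:E <= reach_prob pi s0 B)%E.
Proof.
apply: le_trans (le_reach_prob pi s0 B n); rewrite lee_fin.
elim: n => [|n IH].
  by rewrite occ_sum_upto big_ord0 sumr_ge0// => x _; exact: marginal_ge0.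
rewrite occ_sum_upto big_ord_recr -occ_sum_upto /= -sum_marginal_occ; last first.
  by move=> s a /negbTE sr; rewrite /exit_prob sr.
apply: (@le_trans _ _ (\sum_(x : S * action M | x.1 \in B) marginal pi s0 n x +
   \sum_(x : S * action M) marginal pi s0 n x * exit_prob Sr B P x.1 x.2)).
  by rewrite lerD2r.
rewrite big_mkcond -big_split /=.
under [leRHS]eq_bigr do rewrite marginalS.
rewrite exchange_big /=; apply: ler_sum => x _.
have m_ge0 := marginal_ge0 pi s0 n x.
rewrite -mulr_suml.
have -> : \sum_(y : S * action M | y.1 \in B) kernel pi n x y
    = \sum_(u in B) absorbing_trans absorbed x.1 x.2 u.
  rewrite (eq_bigl (fun y : S * action M => (y.1 \in B) && predT y.2)); last first.
    by move=> y; rewrite andbT.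
  rewrite -(pair_big (fun u => u \in B) predT (fun u b => kernel pi n x (u, b)))/=.
  apply: eq_bigr => u _; rewrite /kernel /= -mulr_sumr -[RHS]mulr1; congr (_ * _).
  rewrite -(dr_sum1 (pi n.+1) u) [RHS]big_mkcond; apply: eq_bigr => b _.
  by case: ifPn => // ub; rewrite dr_avail.
(* Mass in [B] stays there, mass in [Sr] enters [B] with probability [exit_prob], and the rest
   contributes 0 on the left. *)
rewrite [leRHS]mulrC; case: ifPn => xB.
  rewrite /exit_prob (negbTE (target_not_remaining xB)) mulr0 addr0 ler_peMr//.
  rewrite (bigD1 x.1)//= /absorbing_trans finset.inE xB eqxx lerDl.
  by apply: sumr_ge0 => u _; exact: ler0n.
rewrite add0r ler_wpM2l// /exit_prob; case: ifPn => xr; last first.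
  by apply: sumr_ge0 => u _; case/andP: (absorbing_trans01 absorbed x.1 x.2 u).
by apply: ler_sum => u _; rewrite /absorbing_trans -not_remaining xr.
Qed.

End policy.

End expanded_process.

Lemma phi_ge0 (R : realType) (M : labelled_mdp R) (p : AP M) (N : nat)
    (N_gt0 : (0 < N)%N) (eps : R) (s : state (expanded M N_gt0)) a :
  0 <= eps -> 0 <= phi p eps s a.
Proof.
move=> eps_ge0; rewrite /phi; case: ifP => // /andP[_ sa].
rewrite addr_ge0// subr_ge0 VbarE ?ltn_ord//.
by rewrite /max_avail; apply: le_bigmax_cond.
Qed.

(** * Optimality of the selected stationary policy *)

Theorem proposition1 (R : realType) (M : labelled_mdp R) (p : AP M)
    (N : nat) (N_gt0 : (0 < N)%N) (eps : R)
    (lam : state (expanded M N_gt0) -> action (expanded M N_gt0) -> R)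
    (d : decision_rule (expanded_absorbing p N_gt0)) :
  init M \in remaining p ->
  0 <= eps ->
  lp2_optimal p N_gt0 eps lam ->
  deterministic d ->
  (forall s : state (expanded M N_gt0), s \in lift_set N_gt0 (remaining p) ->
     Astar lam s != finset.set0 -> exists2 a, a \in Astar lam s & d s a = 1) ->
  is_minimizer (maximally_reaching p N_gt0) (expected_cost p N_gt0 eps)
    (stationary d).
Proof.
move=> init_r eps_ge0 [[[lam_x lam_flow lam_ge0] lam_vs] lam_min] /choice[sel selE] dstar.
pose Mbar := expanded M N_gt0.
pose Sr : {set state Mbar} := lift_set N_gt0 (remaining p).
pose B : {set state Mbar} := lift_set N_gt0 (target p).
pose av (s : state Mbar) : {set action Mbar} := avail s.
pose P : state Mbar -> action Mbar -> state Mbar -> R := @trans R Mbar.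
pose s0 := init Mbar.
pose c := @phi R M p N N_gt0 eps.
pose r := exit_prob Sr B P.
have s0_r : s0 \in Sr by rewrite /Sr mem_lift_set.
have P_ge0 : forall s a s', 0 <= P s a s' by exact: expanded_trans_ge0.
have P_sum1 s a : a \in av s -> \sum_s' P s a s' = 1 by exact: trans_sum1.
have B_Sr : forall s, s \in B -> s \notin Sr by move=> s; exact: target_not_remaining.
have av_neq0 : forall s, exists a, a \in av s by exact: some_avail.
have no_trap := @remaining_no_trap R M p N N_gt0.
(* [x] and [vs] are real representatives of [xstar] and [vstar eps], available because [lam] attains
   both. *)
pose x := lp_sum p lam (@reach_reward R M p N N_gt0).
pose vs := lp_sum p lam c.
have c_ge0 s a : 0 <= c s a by exact: phi_ge0.
have r_ge0 s a : 0 <= r s a by exact: exit_prob_ge0.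
have c0 s a : s \notin Sr -> c s a = 0 by move=> /negbTE sr; rewrite /c /phi sr.
have r0 s a : s \notin Sr -> r s a = 0 by move=> /negbTE sr; rewrite /r /exit_prob sr.
have feasibleE mu : feasible Sr B av P s0 x mu -> lp_feasible p N_gt0 mu.
  by move=> [mu_x mu_flow mu_ge0]; split => //; rewrite -lam_x; congr (_%:E).
have vs_le mu : feasible Sr B av P s0 x mu -> vs <= occ_sum Sr av mu c.
  move=> /feasibleE mu_feas; rewrite -lee_fin lam_vs.
  by apply: ereal_inf_lbound; exists mu.
have lam_shortest mu : feasible Sr B av P s0 x mu -> occ_sum Sr av mu c = vs ->
    occ_sum Sr av lam (fun _ _ => 1) <= occ_sum Sr av mu (fun _ _ => 1).
  move=> /feasibleE mu_feas mu_vs.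
  have occ1 nu : occ_sum Sr av nu (fun _ _ => 1) = lp2_objective p nu.
    by apply: eq_bigr => s _; apply: eq_bigr => a _; rewrite mulr1.
  rewrite !occ1; apply: lam_min; split => //.
  by rewrite -lam_vs -/vs -mu_vs.
(* The greedy rules form a policy of the absorbing MDP, whose reachability probability is at most
   the supremum [xstar]. *)
have value_x n : value_iter Sr B av P n s0 <= x.
  have [gsel [gsel_av le_g]] := greedy_policy B P_ge0 av_neq0 s0_r n.
  rewrite (le_trans le_g)// -lee_fin lam_x.
  pose g : policy (expanded_absorbing p N_gt0) :=
    fun t => @point_rule R (expanded_absorbing p N_gt0) (gsel t) (gsel_av t).
  apply: le_trans (exit_occ_le_reach g n) _.
  by apply: ereal_sup_ubound; exists g.
(* A deterministic rule gives probability 1 to one action only, so the action from [Astar] is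
   [sel s]. *)
have sel_occ s : s \in occupied Sr av lam -> sel s \in av s /\ 0 < lam s (sel s).
  rewrite finset.inE => /andP[sr /existsP[a /andP[sa lam_gt0]]].
  have [|b bA db] := dstar s sr; first by apply/set0Pn; exists a; rewrite finset.inE sa.
  have bE : b = sel s.
    by apply/eqP; move: (selE s b); rewrite db; case: eqP => // _ /eqP; rewrite oner_eq0.
  by move: bA; rewrite finset.inE bE => /andP[].
have lam_feas : feasible Sr B av P s0 x lam by split.
have [v v_vs [r_cvg c_cvg]] := @selection_optimal R _ _ Sr B av P P_ge0 P_sum1 B_Sr
  av_neq0 s0 s0_r c lam x vs sel d (fun s a _ _ => c_ge0 s a) value_x lam_feas
  erefl vs_le lam_shortest (fun s so => (sel_occ s so).1)
  (fun s so => (sel_occ s so).2) (fun s a _ => selE s a).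
have xE : xstar p N_gt0 = x%:E by rewrite lam_x.
pose occ (pi : policy (expanded_absorbing p N_gt0)) :=
  occ_upto Sr av P s0 (fun t s a => pi t s a).
have totalE pi f : (forall s a, 0 <= f s a) -> (forall s a, s \notin Sr -> f s a = 0) ->
    expected_total pi (init (expanded_absorbing p N_gt0)) f
    = limn (fun n => (occ_sum Sr av (occ pi n) f)%:E).
  exact: expected_total_occ.
have partial_mono pi f : (forall s a, 0 <= f s a) ->
    nondecreasing_seq (fun n => (occ_sum Sr av (occ pi n) f)%:E).
  move=> f_ge0 m n mn; rewrite lee_fin.
  apply: occ_sum_upto_mono => //.
  by move=> t s a; exact: dr_ge0.
have cost_d : expected_cost p N_gt0 eps (stationary d) = v%:E.
  rewrite [LHS]totalE//; apply/cvg_lim => //.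
  by apply: cvg_EFin; [exact: nearW|exact: c_cvg].
split.
  rewrite /maximally_reaching /= xE [LHS]totalE//; apply/cvg_lim => //.
  by apply: cvg_EFin; [exact: nearW|exact: r_cvg].
move=> pi; rewrite /maximally_reaching /= xE => pi_x; rewrite cost_d.
have partial_le n : ((occ_sum Sr av (occ pi n) c)%:E <= expected_cost p N_gt0 eps pi)%E.
  rewrite [leRHS]totalE//.
  have cv := ereal_nondecreasing_cvgn (partial_mono pi c c_ge0).
  rewrite (cvg_lim _ cv)//; apply: ereal_sup_ubound; by exists n.
apply: (@le_trans _ _ vs%:E); first by rewrite lee_fin.
(* Only a finite cost needs the comparison with (LP1); a cost of minus infinity is excluded by the
   real partial sums below it. *)
case costE : (expected_cost p N_gt0 eps pi) partial_le => [ct| |] partial_le.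
- rewrite lee_fin.
  apply: (@optimal_cost_le_policy_cost R _ _ Sr B av P P_ge0 P_sum1 B_Sr av_neq0
    no_trap s0 s0_r (fun t s a => pi t s a) x vs ct c) => //.
  + by move=> t s a; exact: dr_ge0.
  + by move=> t s; exact: (dr_sum1 (pi t) s).
  + move=> y y_ge; rewrite -lee_fin -pi_x [leLHS]totalE//.
    have cv := ereal_nondecreasing_cvgn (partial_mono pi r r_ge0).
    rewrite (cvg_lim _ cv)//; apply: ge_ereal_sup => _ [n _ <-].
    by rewrite lee_fin; exact: y_ge.
- by rewrite leey.
- by have := partial_le 0%N; rewrite leeNy_eq.
Qed.
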